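(* (In ZFC.) Let $\mathfrak c=2^{\aleph_0}$. The additive group $\mathbb Q^{(\mathfrak c)}$, which is isomorphic as a group to $(\mathbb R,+)$, admits a Hausdorff countably compact group topology in which every convergent sequence is eventually constant.
   Context: $\mathbb Q^{(\mathfrak c)}$ denotes the direct sum of $\mathfrak c$ copies of $\mathbb Q$. A group topology on a group is a topology making the group operation and inversion continuous. A space is countably compact if every countable open cover has a finite subcover (for $T_1$ spaces, equivalently, every countably infinite subset has an accumulation point). *)

(* Defs.v *)
From HB Require Import structures.
From mathcomp Require Import all_boot all_order all_algebra.
From mathcomp Require Import monalg.
From mathcomp Require Import all_classical all_reals all_analysis.

Set Implicit Arguments.
Unset Strict Implicit.
Unset Printing Implicit Defensive.

Import GRing.Theory.

Local Open Scope classical_set_scope.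
Local Open Scope ring_scope.

(* [monalg] has to be imported before MathComp-Analysis: their notation levels
   clash in the other order. [{malg rat[I]}] is the group of finitely supported
   functions I -> rat; only its additive structure is used, so that no monoid
   structure is needed on I. *)
Notation "''Q^(' I ')'" := {malg rat[I]}
  (at level 8, I at level 200, format "''Q^(' I ')'") : type_scope.

(* The data of the library's factory [isOpenTopological]; the empty set is open
   as the union of an empty family. *)
Record topology_on (T : Type) : Type := TopologyOn {
  opens : set_system T ;
  opensT : opens setT ;
  opensI : setI_closed opens ;
  opens_bigU : forall (I : Type) (f : I -> set T),
    (forall i, opens (f i)) -> opens (\bigcup_i f i)
}.

(* T with the topology tau, keeping the algebraic structure of T. *)
Definition with_topology (T : Type) (tau : topology_on T) : Type := T.

HB.instance Definition _ (T : choiceType) (tau : topology_on T) :=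
  Choice.copy (with_topology tau) T.
HB.instance Definition _ (T : choiceType) (tau : topology_on T) :=
  isOpenTopological.Build (with_topology tau)
    (opensT tau) (opensI (t := tau)) (opens_bigU (t := tau)).
HB.instance Definition _ (G : zmodType) (tau : topology_on G) :=
  GRing.Zmodule.copy (with_topology tau) G.

Definition group_topology (G : zmodType) (tau : topology_on G) : Prop :=
  continuous (fun x : with_topology tau * with_topology tau => x.1 + x.2) /\
  continuous (fun x : with_topology tau => - x).

(* Same shape as the library's [cover_compact]. *)
Definition countably_compact (T : topologicalType) (A : set T) : Prop :=
  forall (I : choiceType) (D : set I) (f : I -> set T),
    countable D -> (forall i, D i -> open (f i)) ->
    A `<=` \bigcup_(i in D) f i -> finite_subset_cover D f A.

Definition eventually_constant (T : Type) (u : nat -> T) : Prop :=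
  exists x : T, \forall n \near \oo, u n = x.

(* Main.v *)
Require Import Defs.
From HB Require Import structures.
From mathcomp Require Import all_boot all_order all_algebra.
From mathcomp Require Import finmap.
From mathcomp Require Import zify ring lra.
From mathcomp Require Import monalg.
From mathcomp Require Import all_classical all_reals all_analysis.

Set Implicit Arguments.
Unset Strict Implicit.
Unset Printing Implicit Defensive.

Import Order.TTheory GRing.Theory Num.Theory.
Import numFieldNormedType.Exports.

Local Open Scope classical_set_scope.
Local Open Scope card_scope.
Local Open Scope ring_scope.

(** Write V for the group 'Q^(I), with basis vectors chi_x = << 1 *g x >>.

    The topology of V is generated by a set H of homomorphisms to the circle.
    Each index x carries a double sequence s x of vectors, supported on indices
    that precede x in a well-founded relation, and an ultrafilter p x on pairs
    (n, i).  The members of H are the homomorphisms whose value at chi_x is the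
    p x-limit of their values on s x, for all x such that the finite blocks
    (s x n i), i < blocklen n, are dissociated: they satisfy no nontrivial
    integer relation with small coefficients.  So chi_x is an accumulation point
    of s x.  Since V is torsion-free, each choice of a further vector in a
    dissociated block excludes finitely many vectors only, hence a sequence that
    takes no value infinitely often contains dissociated blocks
    ([dissociated_block]).  As every double sequence is s x for two different x
    ([limit_scheme]), such a sequence has an accumulation point, and it cannot
    converge, for it accumulates at two different chi_x.

    What needs an idea is that H separates the points of V
    ([admissible_separates]).  Let v be nonzero.  The indices that can be reached
    from the support of v form a countable set D.  Outside D a homomorphism is
    continued by recursion: its value at chi_x is defined as the required limit
    ([extend_character]).  On D the ultrafilters have to be chosen in advance so
    that all the limit conditions can be met at once.  For almost disjoint
    infinite sets X x of naturals, p x contains every set that misses, in block n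
    for n in X x, few indices compared with the length of the block
    ([block_filter]).  As D is countable, block n can be assigned to a single x
    in D, in such a way that x receives almost all n in X x.  It remains to find
    a homomorphism that does not vanish at v and is almost zero at
    s x n i - chi_x for all but few i of each block n assigned to x.

    This is done block by block.  A vector is in at most one way a combination of
    a dissociated block with small coefficients.  So, given finitely many vectors,
    deleting for each of them one index of the support of its representation
    leaves a subset of the block none of whose nonzero small combinations is one
    of the given vectors ([delete_dependent]).  Applied to the differences of
    elements of a box S of small combinations of the earlier blocks, and to these
    differences shifted by v, it yields a larger box that is disjoint from its
    translate by v and almost invariant under translation by the vectors that
    were kept; the number of deletions depends on the earlier blocks only, and
    the block is longer than that.  The trigonometric polynomial
    |sum_(s in S) e^(i lam s)|^2, as a weight on homomorphisms lam, has the
    numbers of pairs in S with a given difference as Fourier coefficients.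
    Hence, in a suitable finite mean with this weight, 1 - cos lam is small at the
    vectors kept and equal to 1 at v, which yields a single such lam
    ([character_exists]).  An ultrafilter limit over the stages gives the
    homomorphism on D ([limit_character]).

    For the isomorphism with the reals, the numbers sum_(n in X x) 1/n! are
    rationally independent ([independent_reals]), so some Hamel basis of the
    reals has the cardinality of I. *)

(** * Dissociated blocks and boxes *)

(** Dissociation in the sense of Sidon sets and Riesz products. *)
Definition dissociated (G : zmodType) (h : nat -> G) (L B : nat) :=
  forall d : nat -> int, (forall i, (`|d i| <= B)%N) ->
  \sum_(i <- iota 0 L) h i *~ d i = 0 -> forall i, (i < L)%N -> d i = 0.

(** A small defect relative to the size of S means that S is a Foelner set for
    the translation by e. *)
Definition defect (G : zmodType) (S : seq G) (e : G) : nat :=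
  count (fun s => s + e \notin S) S.

(** Bounded coefficients, as for [dissociated], but nontrivial combinations have
    to avoid all of Z.  With the set of [differences] as Z, this makes the sum of
    S and a box over r direct and disjoint from its translate by X. *)
Definition combfree (G : zmodType) (Z : seq G) (h : nat -> G) (r : seq nat)
    (M : nat) :=
  forall d : nat -> int, (forall i, (`|d i| < M)%N) ->
  \sum_(i <- r) h i *~ d i \in Z -> forall i, i \in r -> d i = 0.

Definition differences (G : zmodType) (S : seq G) (X : G) : seq G :=
  [seq s - s' | s <- S, s' <- S] ++ [seq s - s' - X | s <- S, s' <- S].

Lemma subr_cross (G : zmodType) (a b c d : G) :
  a + b = c + d -> b - d = c - a.
Proof.
move=> E; apply/eqP; rewrite subr_eq addrAC eq_sym subr_eq.
by rewrite -E addrC.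
Qed.

Lemma size_differences (G : zmodType) (S : seq G) (X : G) :
  size (differences S X) = (2 * size S ^ 2)%N.
Proof. by rewrite size_cat !size_allpairs mulnn mul2n addnn. Qed.

(** By 2M-dissociation an element of Z is at most one combination of the block
    with coefficients bounded by M; deleting one index of its support destroys
    this representation. *)
Lemma delete_dependent (G : zmodType) (h : nat -> G) (L M : nat) (Z : seq G) :
  dissociated h L (2 * M) ->
  exists rem : seq nat, (size rem <= size Z)%N /\
    combfree Z h [seq i <- iota 0 L | i \notin rem] M.
Proof.
move=> diss.
(* One index serves all representations of z, as there is at most one. *)
have /choice[sel selP] : forall z, exists i : nat, forall d : nat -> int,
    (forall j, (`|d j| <= M)%N) -> \sum_(j <- iota 0 L) h j *~ d j = z ->
    (exists2 j, (j < L)%N & d j <> 0) -> (i < L)%N /\ d i <> 0.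
  move=> z.
  have [[d [dM dz [j jL dj]]]|nex] := pselect (exists d : nat -> int,
    [/\ forall j, (`|d j| <= M)%N, \sum_(j <- iota 0 L) h j *~ d j = z &
        exists2 j, (j < L)%N & d j <> 0]).
    exists j => d' d'M d'z _; split => // d'j; apply: dj.
    suff : d j - d' j = 0 by rewrite d'j subr0.
    apply: (diss (fun j => d j - d' j)) => //.
    - by move=> i; have := dM i; have := d'M i; lia.
    - under eq_bigr do rewrite mulrzBr.
      by rewrite sumrB dz d'z subrr.
  exists 0%N => d dM dz dn0; exfalso; apply: nex; exists d; split => //.
exists (map sel Z); split; first by rewrite size_map.
move=> d dM dZ i; rewrite mem_filter mem_iota /= add0n => /andP[iN iL].
apply: contrapT => di.
pose d' j : int := if j \notin map sel Z then d j else 0.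
have sumE : \sum_(j <- iota 0 L) h j *~ d' j =
    \sum_(j <- [seq i <- iota 0 L | i \notin map sel Z]) h j *~ d j.
  rewrite big_filter [RHS]big_mkcond /=; apply: eq_bigr => j _.
  by rewrite /d'; case: ifP => // _; rewrite mulr0z.
have [||selL []] := selP _ d' _ sumE.
- by move=> j; rewrite /d'; case: ifP => // _; rewrite ltnW.
- by exists i => //; rewrite /d' iN.
by rewrite /d' map_f.
Qed.

Lemma count_allpairs_le (S T U : eqType) (f : S -> T -> U) (p : pred U)
    (k : S -> nat) (s : seq S) (t : seq T) :
  {in s, forall x, count p [seq f x y | y <- t] <= k x}%N ->
  (count p [seq f x y | x <- s, y <- t] <= \sum_(x <- s) k x)%N.
Proof.
elim: s => [|x s IH] kP; first by rewrite big_nil.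
rewrite allpairs_cons count_cat big_cons leq_add ?kP ?mem_head//.
by apply: IH => y ys; rewrite kP// in_cons ys orbT.
Qed.

(** Translating by an element e that was harmless for S stays harmless, and
    translating by h only moves the last term of each progression out. *)
Lemma add_progression (G : zmodType) (S : seq G) (h : G) (M : nat) :
  uniq S -> (0 < M)%N ->
  (forall c : int, (`|c| < M)%N -> h *~ c \in [seq s - s' | s <- S, s' <- S] ->
     c = 0) ->
  let S' := [seq s + h *+ t | s <- S, t <- iota 0 M] in
  [/\ uniq S', size S' = (size S * M)%N,
      forall e, (defect S' e * size S <= defect S e * size S')%N &
      (defect S' h * M <= size S')%N].
Proof.
move=> uS M0 hfree S'.
have sz : size S' = (size S * M)%N by rewrite size_allpairs size_iota.
have memS' s t : s \in S -> (t < M)%N -> s + h *+ t \in S'.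
  by move=> sS tM; apply: allpairs_f => //; rewrite mem_iota.
split => //.
- apply: allpairs_uniq => //; first exact: iota_uniq.
  move=> _ _ /allpairsP[[s t]/= [sS tM ->]] /allpairsP[[s' t']/= [s'S t'M ->]] /= E.
  move: tM t'M; rewrite !mem_iota !add0n /= => tM t'M.
  have E' : h *~ (t%:Z - t'%:Z) = s' - s.
    by rewrite mulrzBr -!pmulrn; apply: subr_cross.
  have : t%:Z - t'%:Z = 0.
    apply: hfree; first by lia.
    by rewrite E'; apply: allpairs_f.
  move=> tt'; have {}tt' : t = t' by lia.
  by move: E; rewrite tt' => /addIr ->.
- move=> e; rewrite sz mulnA mulnAC leq_mul2r; apply/orP; right.
  have -> : (defect S e * M = \sum_(s <- S) if (s + e)%R \notin S then M else 0)%N.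
    by rewrite -big_mkcond big_const_seq iter_addn_0 mulnC.
  apply: count_allpairs_le => s sS; case: ifPn => [_|].
    by rewrite (leq_trans (count_size _ _))// size_map size_iota.
  rewrite negbK => seS; rewrite leqn0 eqn0Ngt -has_count.
  apply/hasPn => _ /mapP[t tM ->]; rewrite negbK addrAC memS'//.
  by move: tM; rewrite mem_iota.
- rewrite sz leq_mul2r; apply/orP; right.
  rewrite -sum1_size.
  apply: count_allpairs_le => s sS; rewrite count_map.
  (* s + h *+ t + h stays in the set unless t is the last multiple *)
  apply: (@leq_trans (count (pred1 M.-1) (iota 0 M))); last first.
    by rewrite count_uniq_mem ?iota_uniq// leq_b1.
  rewrite -!size_filter; apply: uniq_leq_size; first by rewrite filter_uniq ?iota_uniq.
  move=> t; rewrite !mem_filter /= => /andP[+ tM]; rewrite tM andbT.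
  move: tM; rewrite mem_iota add0n => tM; apply: contraR => tM1.
  by rewrite -addrA -mulrSr memS'//; lia.
Qed.

(** One progression at a time; [combfree] passes from S to the larger set since
    the coefficient of the new direction can be moved to the other side. *)
Lemma add_box (G : zmodType) (X : G) (h : nat -> G) (M : nat) (r : seq nat)
    (S : seq G) :
  uniq r -> (0 < M)%N -> uniq S -> (0 < size S)%N ->
  {in S, forall s, s + X \notin S} ->
  combfree (differences S X) h r M ->
  exists S' : seq G,
  [/\ uniq S', {in S', forall s, s + X \notin S'},
      size S' = (size S * M ^ size r)%N,
      forall e, (defect S' e * size S <= defect S e * size S')%N &
      {in r, forall i, (defect S' (h i) * M <= size S')%N}].
Proof.
move=> + M0; elim: r S => [|x r IH] S /= ur uS S0 XS free.
  by exists S; split => //; rewrite ?expn0 ?muln1.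
case/andP: ur => xr ur.
have free1 (c : int) (d : nat -> int) : (`|c| < M)%N ->
    (forall i, (`|d i| < M)%N) ->
    h x *~ c + \sum_(i <- r) h i *~ d i \in differences S X ->
    c = 0 /\ {in r, forall i, d i = 0}.
  move=> cM dM H; pose d' i := if i == x then c else d i.
  have d'0 : forall i, i \in x :: r -> d' i = 0.
    apply: free; first by move=> i; rewrite /d'; case: ifP.
    rewrite big_cons {1}/d' eqxx; suff -> : \sum_(j <- r) h j *~ d' j =
      \sum_(j <- r) h j *~ d j by [].
    apply: eq_big_seq => i ir; rewrite /d'; case: eqP => // ix.
    by move: xr; rewrite -ix ir.
  split; first by have := d'0 x (mem_head _ _); rewrite /d' eqxx.
  move=> i ir; have := d'0 i; rewrite in_cons ir orbT => /(_ isT).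
  by rewrite /d'; case: eqP => // ix; move: xr; rewrite -ix ir.
have free0 (c : int) : (`|c| < M)%N -> h x *~ c \in differences S X -> c = 0.
  move=> cM H; apply: (proj1 (free1 c (fun=> 0) cM _ _)) => //.
  by rewrite big1 ?addr0// => i _; rewrite mulr0z.
have [|uS1 szS1 dS1 dhx] := @add_progression G S (h x) M uS M0.
  by move=> c cM H; apply: free0; rewrite // mem_cat H.
set S1 := [seq s + h x *+ t | s <- S, t <- iota 0 M] in uS1 szS1 dS1 dhx.
have S10 : (0 < size S1)%N by rewrite szS1 muln_gt0 S0.
have XS1 : {in S1, forall s, s + X \notin S1}.
  move=> _ /allpairsP[[s t]/= [sS tM ->]]; apply/negP.
  move=> /allpairsP[[s' t']/= [s'S t'M E]].
  move: tM t'M; rewrite !mem_iota !add0n /= => tM t'M.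
  have tt : t%:Z - t'%:Z = 0.
    apply: free0; first by lia.
    rewrite mem_cat; apply/orP; right.
    have -> : h x *~ (t%:Z - t'%:Z) = s' - s - X.
      rewrite mulrzBr -!pmulrn -addrA -opprD; apply: subr_cross.
      by rewrite addrAC.
    exact: allpairs_f.
  have {}tt : t = t' by lia.
  move: E; rewrite tt addrAC => /addIr E.
  by have := XS s sS; rewrite E s'S.
have free2 : combfree (differences S1 X) h r M.
  move=> d dM; rewrite mem_cat.
  have diffE s t s' t' : s + h x *+ t - (s' + h x *+ t') =
      (s - s') - h x *~ (t'%:Z - t%:Z).
    by rewrite mulrzBr -!pmulrn opprD addrACA opprB.
  case/orP => /allpairsP[[s s']/= [/allpairsP[[{}s t]/= [sS tM ->]]
      /allpairsP[[{}s' t']/= [s'S t'M ->]] E]].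
    apply: (proj2 (free1 (t'%:Z - t%:Z) d _ dM _)).
      by move: tM t'M; rewrite !mem_iota; lia.
    rewrite E diffE addrC subrK mem_cat; apply/orP; left.
    exact: (allpairs_f (fun s s' => s - s')).
  apply: (proj2 (free1 (t'%:Z - t%:Z) d _ dM _)).
    by move: tM t'M; rewrite !mem_iota; lia.
  rewrite E diffE addrC addrAC subrK mem_cat; apply/orP; right.
  exact: (allpairs_f (fun s s' => s - s' - X)).
have [S' [uS' XS' szS' dS' dr]] := IH S1 ur uS1 S10 XS1 free2.
exists S'; split => //.
- by rewrite szS' szS1 expnS mulnA.
- move=> e; rewrite -(leq_pmul2r S10) mulnAC.
  apply: (leq_trans (leq_mul (dS' e) (leqnn _))).
  by rewrite mulnAC -[leqRHS]mulnAC leq_mul2r dS1 orbT.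
- move=> i; rewrite in_cons => /orP[/eqP ->|]; last exact: dr.
  rewrite -(leq_pmul2r S10) mulnAC.
  apply: (leq_trans (leq_mul (dS' _) (leqnn _))).
  by rewrite mulnAC mulnC leq_mul2l dhx orbT.
Qed.

Lemma stage_step (G : zmodType) (X : G) (h : nat -> G) (L M : nat) (S : seq G) :
  (0 < M)%N -> uniq S -> (0 < size S)%N -> {in S, forall s, s + X \notin S} ->
  dissociated h L (2 * M) ->
  exists S' rem : seq _,
  [/\ uniq S', {in S', forall s, s + X \notin S'},
      (0 < size S' <= size S * M ^ L)%N, (size rem <= 2 * size S ^ 2)%N &
      (forall e, (defect S' e * size S <= defect S e * size S')%N) /\
      (forall i, (i < L)%N -> i \notin rem -> (defect S' (h i) * M <= size S')%N)].
Proof.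
move=> M0 uS S0 XS diss.
have [rem [szr free]] := delete_dependent (differences S X) diss.
have [|S' [uS' XS' szS' dS' dr]] := add_box _ M0 uS S0 XS free.
  by rewrite filter_uniq// iota_uniq.
exists S', rem; split => //.
- rewrite szS' muln_gt0 S0 expn_gt0 M0/= leq_mul2l leq_pexp2l// ?orbT//.
  by rewrite size_filter (leq_trans (count_size _ _))// size_iota.
- by rewrite -(size_differences S X).
- by split => // i iL ir; apply: dr; rewrite mem_filter ir mem_iota.
Qed.

(** In block n the box S built so far has at most b = [boxsize n] elements, hence
    2 * b ^ 2 [differences] and as many deletions.  The length makes n times that
    number a proper part of the block, and the multiplicity makes the total
    weighted defect at most 1/2 of the box. *)
Definition blocklen_from (n b : nat) : nat := (n * (2 * b ^ 2)).+1.
Definition blockmult_from (n b : nat) : nat := (n.+1 * blocklen_from n b * 2 ^ n.+2)%N.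
Fixpoint boxsize (n : nat) : nat :=
  if n is m.+1 then
    (boxsize m * blockmult_from m (boxsize m) ^ blocklen_from m (boxsize m))%N
  else 1%N.

Arguments boxsize : simpl never.

Definition blockloss (n : nat) : nat := (2 * boxsize n ^ 2)%N.
Definition blocklen (n : nat) : nat := blocklen_from n (boxsize n).
Definition blockmult (n : nat) : nat := blockmult_from n (boxsize n).

Arguments blockloss : simpl never.
Arguments blocklen : simpl never.
Arguments blockmult : simpl never.

Lemma blocklenE n : blocklen n = (n * blockloss n).+1. Proof. by []. Qed.
Lemma blockmultE n : blockmult n = (n.+1 * blocklen n * 2 ^ n.+2)%N. Proof. by []. Qed.
Lemma boxsizeS n : boxsize n.+1 = (boxsize n * blockmult n ^ blocklen n)%N.
Proof. by []. Qed.
Lemma blockmult_gt0 n : (0 < blockmult n)%N.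
Proof. by rewrite blockmultE muln_gt0 muln_gt0 expn_gt0. Qed.

(** Iterates [stage_step]; the box stays as it is at a block for which [good]
    fails. *)
Lemma stages (G : zmodType) (X : G) (h : nat -> nat -> G) (good : nat -> Prop) :
  X <> 0 -> (forall n, good n -> dissociated (h n) (blocklen n) (2 * blockmult n)) ->
  exists (S : nat -> seq G) (rem : nat -> seq nat),
  (forall n, [/\ uniq (S n), (0 < size (S n))%N, {in S n, forall s, s + X \notin S n}
               & (size (rem n) <= blockloss n)%N]) /\
  (forall n m i, (m < n)%N -> good m -> (i < blocklen m)%N -> i \notin rem m ->
     (defect (S n) (h m i) * blockmult m <= size (S n))%N).
Proof.
move=> X0 hgood.
pose inv n (S : seq G) := [/\ uniq S, (0 < size S <= boxsize n)%N &
  {in S, forall s, s + X \notin S}].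
have /choice[f fP] : forall nS : nat * seq G, exists p : seq G * seq nat,
    inv nS.1 nS.2 -> [/\ inv nS.1.+1 p.1, (size p.2 <= blockloss nS.1)%N,
      forall e, (defect p.1 e * size nS.2 <= defect nS.2 e * size p.1)%N &
      good nS.1 -> forall i, (i < blocklen nS.1)%N -> i \notin p.2 ->
        (defect p.1 (h nS.1 i) * blockmult nS.1 <= size p.1)%N].
  move=> [n S] /=.
  have [[uS /andP[S0 Sn] XS]|] := pselect (inv n S); last by exists (S, [::]).
  have [gn|ngn] := pselect (good n).
    have [S' [rem [uS' XS' /andP[S'0 S'n] szr [dS' dr]]]] :=
      stage_step (blockmult_gt0 n) uS S0 XS (hgood n gn).
    exists (S', rem) => _; split => //=.
    - split => //; rewrite S'0/= boxsizeS (leq_trans S'n)// leq_mul2r Sn orbT//.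
    - by rewrite (leq_trans szr)// leq_mul2l leq_sqr Sn.
  exists (S, [::]) => _; split => //=; split => //.
  by rewrite S0/= boxsizeS (leq_trans Sn)// leq_pmulr// expn_gt0 blockmult_gt0.
pose fix S n := if n is m.+1 then (f (m, S m)).1 else [:: 0].
have invS n : inv n (S n).
  elim: n => [|n IH]; last by have [] := fP (n, S n) IH.
  split => //= s; rewrite !inE => /eqP ->; rewrite add0r; exact/eqP.
have step n := fP (n, S n) (invS n).
exists S, (fun n => (f (n, S n)).2); split => [n|n m i].
  by have [? /andP[? _] ?] := invS n; have [_ ? _ _] := step n.
move=> + gm iL ir; elim: n => // n IH; rewrite ltnS leq_eqVlt => /orP[/eqP mn|mn].
  by subst m; have [_ _ _] := step n; apply.
have [_ _ /(_ (h m i)) /= le _] := step n; have {}IH := IH mn.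
have [_ /andP[S0 _] _] := invS n.
rewrite -(leq_pmul2r S0) mulnAC (leq_trans (leq_mul le (leqnn _)))//.
by rewrite mulnAC mulnC leq_mul2l IH orbT.
Qed.

(** * From almost invariant sets to characters *)

Section characters.
Variables (R : realType) (G : zmodType).

(** For nonzero w in W let mu_w w = pi, and take all sums of mu_w over sets of
    such w: the sum of e^(i lam v) over these functionals lam is the product of
    the 1 + e^(i mu_w v), one factor of which vanishes for each nonzero v in W. *)
Lemma vanishing_mean (W : seq G) :
  (forall v : G, v != 0 -> exists lam : {additive G -> R}, lam v = pi) ->
  exists Lam : seq {additive G -> R}, (0 < size Lam)%N /\
    {in W, forall v, v != 0 ->
       \sum_(lam <- Lam) cos (lam v) = 0 /\ \sum_(lam <- Lam) sin (lam v) = 0}.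
Proof.
move=> sep; elim: W => [|w W [Lam [Lam0 LamP]]].
  by exists [:: (\0%R : {additive G -> R})].
have [-> |w0] := eqVneq w 0.
  exists Lam; split => // v; rewrite in_cons => /orP[/eqP ->|].
    by rewrite eqxx.
  exact: LamP.
have [mu muw] := sep w w0.
pose shift (lam : {additive G -> R}) : {additive G -> R} := lam \+ mu.
exists (Lam ++ map shift Lam); split; first by rewrite size_cat addn_gt0 Lam0.
have E v : \sum_(lam <- Lam ++ map shift Lam) cos (lam v) =
    (1 + cos (mu v)) * (\sum_(lam <- Lam) cos (lam v)) -
    sin (mu v) * (\sum_(lam <- Lam) sin (lam v)) /\
    \sum_(lam <- Lam ++ map shift Lam) sin (lam v) =
    (1 + cos (mu v)) * (\sum_(lam <- Lam) sin (lam v)) +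
    sin (mu v) * (\sum_(lam <- Lam) cos (lam v)).
  rewrite !big_cat !big_map /=; split.
    rewrite [X in _ + X = _](_ : _ = \sum_(lam <- Lam)
      (cos (lam v) * cos (mu v) - sin (lam v) * sin (mu v))); last first.
      by apply: eq_bigr => lam _; rewrite cosD.
    by rewrite sumrB -!mulr_suml; ring.
  rewrite [X in _ + X = _](_ : _ = \sum_(lam <- Lam)
    (sin (lam v) * cos (mu v) + cos (lam v) * sin (mu v))); last first.
    by apply: eq_bigr => lam _; rewrite sinD.
  by rewrite big_split /= -!mulr_suml; ring.
move=> v; rewrite in_cons => vW v0; have [-> ->] := E v.
have [->|vw] := eqVneq v w; first by rewrite muw cospi sinpi; split; ring.
have {}vW : v \in W by case/orP: vW => // /eqP vw'; rewrite vw' eqxx in vw.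
by have [-> ->] := LamP v vW v0; split; ring.
Qed.

(** The double sum of e^(i lam (s - s')) is real, so multiplying it by
    e^(i lam v) and taking real parts multiplies it by cos (lam v). *)
Lemma weight_cos (S : seq G) (lam : {additive G -> R}) (v : G) :
  ((\sum_(s <- S) cos (lam s)) ^+ 2 + (\sum_(s <- S) sin (lam s)) ^+ 2) * cos (lam v)
  = \sum_(s <- S) \sum_(s' <- S) cos (lam (s - s' + v)).
Proof.
set A := \sum_(s <- S) cos (lam s); set B := \sum_(s <- S) sin (lam s).
have E s : \sum_(s' <- S) cos (lam (s - s' + v)) =
    (cos (lam s) * cos (lam v) - sin (lam s) * sin (lam v)) * A +
    (sin (lam s) * cos (lam v) + cos (lam s) * sin (lam v)) * B.
  rewrite !mulr_sumr -big_split /=; apply: eq_bigr => s' _.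
  by rewrite raddfD raddfB cosD sinB cosB; ring.
under eq_bigr do rewrite E.
rewrite big_split /= -!mulr_suml sumrB big_split /= -!mulr_suml -/A -/B; ring.
Qed.

Lemma weighted_witness (T : Type) (r : seq T) (P F : T -> R) :
  (forall i, 0 <= P i) -> 0 < \sum_(i <- r) P i -> 0 <= \sum_(i <- r) P i * F i ->
  exists i, 0 <= F i.
Proof.
move=> P0 Ppos Fpos; apply: contrapT => neg.
have {}neg i : F i < 0 by rewrite ltNge; apply/negP => Fi; apply: neg; exists i.
suff : \sum_(i <- r) P i * F i < 0 by rewrite ltNge Fpos.
elim: r Ppos {Fpos} => [|i r IH]; rewrite ?big_nil ?ltxx// !big_cons.
have PF j : P j * F j <= 0 by rewrite mulr_ge0_le0// ltW.
have [->|Pi0 _] := eqVneq (P i) 0; first by rewrite mul0r !add0r.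
rewrite ltr_nwDl//; first by rewrite pmulr_rlt0// lt_neqAle eq_sym Pi0 P0.
by rewrite sumr_le0.
Qed.

(** In the mean over the functionals of [vanishing_mean], the weight P times
    cos (lam u) counts the pairs of S with difference u.  So the P-mean of
    1 - cos (lam X) is 1 while that of the weighted sum is at most 1/2, and some
    lam is at least as good as the mean. *)
Lemma character_exists (S : seq G) (X : G) (E : seq (G * R)) :
  (forall v : G, v != 0 -> exists lam : {additive G -> R}, lam v = pi) ->
  uniq S -> (0 < size S)%N -> {in S, forall s, s + X \notin S} ->
  \sum_(p <- E) p.2 * (defect S p.1)%:R <= 2^-1 * (size S)%:R ->
  exists lam : {additive G -> R},
    \sum_(p <- E) p.2 * (1 - cos (lam p.1)) + 2^-1 <= 1 - cos (lam X).
Proof.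
move=> sep uS S0 XS dE.
(* V includes 0, whose mean is the total mass of P. *)
pose V := 0 :: X :: map fst E.
pose W := [seq d + v | d <- [seq s - s' | s <- S, s' <- S], v <- V].
have [Lam [Lam0 LamP]] := vanishing_mean W sep.
pose P lam : R := (\sum_(s <- S) cos ((lam : {additive G -> R}) s)) ^+ 2 +
  (\sum_(s <- S) sin (lam s)) ^+ 2.
have mean v : v \in V -> \sum_(lam <- Lam) P lam * cos (lam v) =
    (size Lam)%:R * ((size S)%:R - (defect S v)%:R).
  move=> vV; under eq_bigr do rewrite weight_cos.
  rewrite exchange_big /=; transitivity
      (\sum_(s <- S) (size Lam)%:R * (s + v \in S)%:R : R).
    apply: eq_big_seq => s sS; rewrite exchange_big /=.
    transitivity (\sum_(s' <- S) (size Lam)%:R * (s' == s + v)%:R : R).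
      apply: eq_big_seq => s' s'S.
      have -> : (s' == s + v) = (s - s' + v == 0).
        by rewrite addrAC subr_eq0 eq_sym.
      have [->|n0] := eqVneq (s - s' + v) 0.
        under eq_bigr do rewrite raddf0 cos0.
        by rewrite mulr1 big_const_seq count_predT iter_addr_0.
      rewrite mulr0; apply: (proj1 (LamP _ _ n0)).
      by apply: allpairs_f => //; exact: allpairs_f.
    rewrite -mulr_sumr -natr_sum; congr (_ * _%:R).
    by rewrite -big_mkcond /= sum1_count count_uniq_mem.
  rewrite -mulr_sumr -natr_sum; congr (_ * _).
  apply/eqP; rewrite eq_sym subr_eq -natrD; apply/eqP; congr _%:R.
  by rewrite -big_mkcond /= sum1_count /defect -(count_predC [pred s | s + v \in S]).
have d0 : defect S 0 = 0%N.
  apply/eqP; rewrite eqn0Ngt -has_count; apply/hasPn => s sS.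
  by rewrite addr0 negbK.
have dX : defect S X = size S.
  by apply/eqP; rewrite -all_count; apply/allP => s /XS.
have meanP : \sum_(lam <- Lam) P lam = (size Lam)%:R * (size S)%:R.
  transitivity (\sum_(lam <- Lam) P lam * cos (lam 0)).
    by apply: eq_bigr => lam _; rewrite raddf0 cos0 mulr1.
  by rewrite mean ?mem_head// d0 subr0.
pose F (lam : {additive G -> R}) := 1 - cos (lam X) - 2^-1 -
  \sum_(p <- E) p.2 * (1 - cos (lam p.1)).
suff [lam Flam] : exists lam, 0 <= F lam.
  by exists lam; move: Flam; rewrite /F; lra.
apply: (@weighted_witness _ Lam P).
- by move=> lam; rewrite addr_ge0// sqr_ge0.
- by rewrite meanP mulr_gt0// ltr0n.
have -> : \sum_(lam <- Lam) P lam * F lam = (size Lam)%:R *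
    (2^-1 * (size S)%:R - \sum_(p <- E) p.2 * (defect S p.1)%:R).
  transitivity (2^-1 * \sum_(lam <- Lam) P lam -
      \sum_(lam <- Lam) P lam * cos (lam X) -
      \sum_(p <- E) p.2 * (\sum_(lam <- Lam) P lam -
        \sum_(lam <- Lam) P lam * cos (lam p.1))).
    have -> : \sum_(p <- E) p.2 * (\sum_(lam <- Lam) P lam -
        \sum_(lam <- Lam) P lam * cos (lam p.1)) =
        \sum_(lam <- Lam) P lam * \sum_(p <- E) p.2 * (1 - cos (lam p.1)).
      under [RHS]eq_bigr do rewrite mulr_sumr.
      rewrite exchange_big /=; apply: eq_bigr => p _.
      rewrite -sumrB mulr_sumr; apply: eq_bigr => lam _; ring.
    by rewrite mulr_sumr -!sumrB; apply: eq_bigr => lam _; rewrite /F; field.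
  rewrite meanP mean ?in_cons ?eqxx ?orbT// dX subrr mulr0 subr0 mulrBr mulrCA.
  congr (_ - _); rewrite mulr_sumr; apply: eq_big_seq => p pE.
  by rewrite mean ?in_cons ?map_f ?orbT//; ring.
by rewrite mulr_ge0// subr_ge0.
Qed.
End characters.

(** * Real numbers as angles *)

Section chord.
Variable R : realType.
Implicit Types x y : R.

(** Half the square of the distance from e^(i x) to 1.  Working with angles and
    [chord] replaces a circle group: chord (x - y) = 0 says that x and y are the
    same angle, and up to the factor 2 in [chordD] chord is a norm. *)
Definition chord x : R := 1 - cos x.

Lemma chord_ge0 x : 0 <= chord x.
Proof. by rewrite subr_ge0 cos_le1. Qed.

Lemma chord_le2 x : chord x <= 2.
Proof. by rewrite /chord; have := cos_geN1 x; lra. Qed.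

Lemma chord0 : chord 0 = 0.
Proof. by rewrite /chord cos0 subrr. Qed.

Lemma chordN x : chord (- x) = chord x.
Proof. by rewrite /chord cosN. Qed.

(** The parallelogram law for e^(i x) - 1 and e^(- i y) - 1. *)
Lemma chordD x y : chord (x + y) <= 2 * (chord x + chord y).
Proof.
rewrite /chord cosD; have := cos2Dsin2 x; have := cos2Dsin2 y.
set a := cos x; set b := cos y; set c := sin x; set d := sin y => yE xE.
have := sqr_ge0 (a + b - 2); have := sqr_ge0 (c - d); nra.
Qed.

Lemma chord_eq0D x y : chord x = 0 -> chord y = 0 -> chord (x + y) = 0.
Proof.
move=> x0 y0; apply/eqP; rewrite eq_le chord_ge0 andbT.
by apply: le_trans (chordD _ _) _; rewrite x0 y0 addr0 mulr0.
Qed.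

Lemma chord_eq0B x y : chord x = 0 -> chord y = 0 -> chord (x - y) = 0.
Proof. by move=> x0 y0; apply: chord_eq0D; rewrite ?chordN. Qed.

Lemma chord_addr x y : chord y = 0 -> chord (x + y) = chord x.
Proof.
rewrite /chord cosD => /eqP; rewrite subr_eq0 eq_sym => /eqP y1.
have := cos2Dsin2 y; rewrite y1 expr1n => /eqP.
rewrite -subr_eq0 addrC addKr sqrf_eq0 => /eqP ->.
by rewrite mulr1 mulr0 subr0.
Qed.

Lemma chord_congr x y : chord (x - y) = 0 -> chord x = chord y.
Proof. by move=> xy; rewrite -(subrK y x) addrC chord_addr. Qed.

Lemma chord_sum (I : Type) (r : seq I) (P : pred I) (F H : I -> R) :
  (forall i, P i -> chord (F i - H i) = 0) ->
  chord (\sum_(i <- r | P i) F i - \sum_(i <- r | P i) H i) = 0.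
Proof.
move=> FH; rewrite -sumrB; apply: (big_ind (fun x => chord x = 0)) => //.
- exact: chord0.
- exact: chord_eq0D.
Qed.

Lemma chord_small_eq0 x : (forall e, 0 < e -> chord x <= e) -> chord x = 0.
Proof.
move=> small; apply/eqP; rewrite eq_le chord_ge0 andbT.
by apply/ler_addgt0Pr => e e0; rewrite add0r small.
Qed.

Lemma chord_repr x : exists2 y, - pi <= y <= pi & chord (x - y) = 0.
Proof.
have c1 : -1 <= cos x <= 1 by rewrite cos_geN1 cos_le1.
have cK : cos (acos (cos x)) = cos x by rewrite acosK// in_itv/=.
have sE : sin (acos (cos x)) = `|sin x|.
  by rewrite sin_acos// -sqrtr_sqr; congr Num.sqrt; have := cos2Dsin2 x; lra.
have ac0 := acos_ge0 c1; have acpi := acos_lepi c1; have p0 := pi_ge0 R.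
have := cos2Dsin2 x => E.
have [s0|s0] := leP 0 (sin x).
  exists (acos (cos x)); first lra.
  by rewrite /chord cosB cK sE ger0_norm//; lra.
exists (- acos (cos x)); first lra.
by rewrite /chord opprK cosD cK sE ltr0_norm//; lra.
Qed.

(** Convergence of angles along p; the limit l is a real number, determined
    modulo 2 pi. *)
Definition anglim (T : Type) (p : set_system T) (a : T -> R) (l : R) :=
  forall e, 0 < e -> p [set t | chord (a t - l) < e].

Lemma anglim_exists (T : Type) (p : set_system T) (a : T -> R) :
  UltraFilter p -> exists l, anglim p a l.
Proof.
move=> pU; have pP : ProperFilter p by exact: ultra_proper.
have /choice[b bP] : forall t, exists y, - pi <= y <= pi /\ chord (a t - y) = 0.
  by move=> t; have [y ? ?] := chord_repr (a t); exists y.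
have [l [_ lcl]] : (`[- pi, pi]%classic `&` cluster (b @ p)) !=set0.
  apply: (@segment_compact R); rewrite /fmap/=.
  by apply: filterS filterT => t _ /=; rewrite in_itv/=; case: (bP t).
exists l => e e0.
have nl : nbhs l [set y | chord (y - l) < e].
  have cl : cos (y - l) @[y --> l] --> (1 : R).
    rewrite -[X in _ --> X](_ : cos (l - l) = 1); last by rewrite subrr cos0.
    apply: (@continuous_comp _ _ _ (fun y => y - l) cos).
      by apply: cvgB; [exact: cvg_id|exact: cvg_cst].
    exact: continuous_cos.
  have e1 : 1 - e < 1 by lra.
  apply: filterS (cvgr_gt _ cl _ e1) => y /=; rewrite /chord; lra.
have [H|H] := in_ultra_setVsetC [set t | chord (b t - l) < e] pU.
  apply: filterS H => t /=; have [_ b0] := bP t.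
  have -> : a t - l = (b t - l) + (a t - b t) by ring.
  by rewrite (chord_addr _ b0).
have [y [/= yb yl]] := lcl [set y | ~ (chord (y - l) < e)] _ H nl.
by [].
Qed.

Lemma anglimD (T : Type) (p : set_system T) (a b c : T -> R) (la lb lc : R) :
  ProperFilter p -> (forall t, chord (c t - (a t + b t)) = 0) ->
  anglim p a la -> anglim p b lb -> anglim p c lc -> chord (lc - (la + lb)) = 0.
Proof.
move=> pP cE ala blb clc; apply: chord_small_eq0 => e e0.
have e1 : 0 < e / 16 by lra.
have [t [[/= at_ bt] ct]] :=
  filter_ex (filterI (filterI (ala _ e1) (blb _ e1)) (clc _ e1)).
have -> : lc - (la + lb) =
    (a t - la) + (b t - lb) - (c t - lc) + (c t - (a t + b t)) by ring.
rewrite (chord_addr _ (cE t)).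
apply: (le_trans (chordD _ _)); rewrite chordN /= in ct *.
have := chordD (a t - la) (b t - lb); lra.
Qed.

End chord.

Section limit_character.
Variables (R : realType) (G : zmodType).

(** A homomorphism to the circle, given by a choice of angles. *)
Definition circle_character (lam : G -> R) :=
  forall v w, chord (lam (v + w) - (lam v + lam w)) = 0.

Lemma geom_half (n : nat) :
  \sum_(0 <= m < n) (2 ^- m.+2 : R) = 2^-1 - 2 ^- n.+1.
Proof.
elim: n => [|n IH]; first by rewrite big_geq// expr1 subrr.
rewrite big_nat_recr//= IH !exprS; field.
by rewrite expf_neq0// pnatr_eq0.
Qed.

(** Weight m + 1 for the vectors of block m: their total weighted defect is at
    most the sum of the 2 ^- (m + 2), because a vector kept in block m has defect
    at most size S / blockmult m. *)
Lemma stage_character (X : G) (h : nat -> nat -> G) (good : nat -> Prop)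
    (S : seq G) (rem : nat -> seq nat) (n : nat) :
  (forall v : G, v != 0 -> exists lam : {additive G -> R}, lam v = pi) ->
  uniq S -> (0 < size S)%N -> {in S, forall s, s + X \notin S} ->
  (forall m i, (m < n)%N -> good m -> (i < blocklen m)%N -> i \notin rem m ->
     (defect S (h m i) * blockmult m <= size S)%N) ->
  exists lam : {additive G -> R}, 2^-1 <= chord (lam X) /\
  forall m i, (m < n)%N -> good m -> (i < blocklen m)%N -> i \notin rem m ->
     m.+1%:R * chord (lam (h m i)) <= 2.
Proof.
move=> sep uS S0 XS dS.
pose idx m := [seq i <- index_iota 0 (blocklen m) | i \notin rem m].
pose E : seq (G * R) := [seq (h m i, m.+1%:R) |
  m <- [seq m <- index_iota 0 n | `[< good m >]], i <- idx m].
have SR0 : 0 < (size S)%:R :> R by rewrite ltr0n.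
have [|lam] := @character_exists R G S X E sep uS S0 XS.
  rewrite big_allpairs_dep /= big_filter.
  apply: (@le_trans _ _ (\sum_(0 <= m < n) (size S)%:R * 2 ^- m.+2)); last first.
    rewrite -mulr_sumr geom_half mulrC ler_pM2r// lerBlDr lerDl.
    by rewrite invr_ge0 exprn_ge0.
  rewrite big_mkcond /= !big_nat; apply: ler_sum => m mn.
  case: asboolP => [gm|_]; last by rewrite mulr_ge0// invr_ge0 exprn_ge0.
  rewrite /idx big_filter big_mkcond.
  apply: (@le_trans _ _ (\sum_(0 <= i < blocklen m)
      m.+1%:R * ((size S)%:R / (blockmult m)%:R))).
    rewrite !big_nat; apply: ler_sum => i im.
    case: ifPn => ir; last by rewrite mulr_ge0// divr_ge0.
    rewrite ler_pM2l ?ltr0n// ler_pdivlMr ?ltr0n ?blockmult_gt0// -natrM ler_nat.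
    exact: dS.
  rewrite sumr_const_nat subn0 blockmultE 2!natrM natrX -mulr_natr.
  have l0 : (blocklen m)%:R != 0 :> R by rewrite blocklenE pnatr_eq0.
  have m0 : m.+1%:R != 0 :> R by rewrite pnatr_eq0.
  have t0 : (2 ^+ m.+2 : R) != 0 by rewrite expf_neq0// pnatr_eq0.
  rewrite le_eqVlt; apply/orP; left; apply/eqP; field.
  by rewrite t0 l0 nat1r m0.
move=> lamE; exists lam.
have E0 p : p \in E -> 0 <= p.2 * (1 - cos (lam p.1)).
  move=> /allpairsPdep[m [i [_ _ ->]]] /=.
  by rewrite mulr_ge0// chord_ge0.
split.
  apply: le_trans lamE; rewrite lerDr big_seq sumr_ge0//.
move=> m i mn gm iL ir.
have pE : (h m i, m.+1%:R) \in E.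
  apply/allpairsPdep; exists m, i; split => //.
    by rewrite mem_filter mem_index_iota mn; case: asboolP.
  by rewrite mem_filter ir mem_index_iota.
move: lamE; rewrite (big_rem _ pE) /= => lamE.
have : 0 <= \sum_(y <- seq.rem (h m i, m.+1%:R) E) y.2 * (1 - cos (lam y.1)).
  rewrite big_seq sumr_ge0// => p /mem_rem; exact: E0.
have := chord_le2 (lam X); rewrite /chord; lra.
Qed.

(** The constraints of stage n concern the blocks before n and persist, so they
    survive in an ultrafilter limit of the characters of all stages, up to a
    factor from [chordD]. *)
Lemma limit_character (X : G) (h : nat -> nat -> G) (good : nat -> Prop) :
  (forall v : G, v != 0 -> exists lam : {additive G -> R}, lam v = pi) ->
  X != 0 -> (forall n, good n -> dissociated (h n) (blocklen n) (2 * blockmult n)) ->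
  exists (lam : G -> R) (rem : nat -> seq nat),
  [/\ circle_character lam, chord (lam X) != 0,
      forall n, (size (rem n) <= blockloss n)%N &
      forall n i, good n -> (i < blocklen n)%N -> i \notin rem n ->
        chord (lam (h n i)) <= 6 / n.+1%:R].
Proof.
move=> sep /eqP X0 hgood.
have [S [rem [Sn dS]]] := stages X0 hgood.
have /choice[a aP] := fun n => let: And4 uS S0 XS _ := Sn n in
  stage_character sep uS S0 XS (fun m i => dS n m i).
have [u [uU ufine]] : exists u : set_system nat, UltraFilter u /\ \oo `<=` u.
  exact: ultraFilterLemma.
have uP : ProperFilter u by exact: ultra_proper.
have /choice[lam lamP] := fun v : G => anglim_exists (fun n => a n v) uU.
exists lam, rem; split.
- move=> v w; apply: (anglimD uP _ (lamP v) (lamP w) (lamP (v + w))) => n.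
  by rewrite raddfD subrr chord0.
- have e0 : (0 : R) < 1 / 8 by lra.
  have [n /= nX] := filter_ex (lamP X _ e0).
  have [aX _] := aP n.
  apply/eqP => X1; have := chordD (a n X - lam X) (lam X); rewrite subrK X1; lra.
- by move=> n; have [] := Sn n.
- move=> n i gn iL ir; have n0 : (0 : R) < n.+1%:R by rewrite ltr0n.
  have e0 : (0 : R) < n.+1%:R^-1 by rewrite invr_gt0.
  have [m [/= ml nm]] :
      [set m | chord (a m (h n i) - lam (h n i)) < n.+1%:R^-1] `&`
      [set m | (n < m)%N] !=set0.
    apply: (@filter_ex _ u); apply: filterI; first exact: (lamP (h n i) _ e0).
    by apply: ufine; exists n.+1.
  have [_ /(_ n i nm gn iL ir)] := aP m.
  rewrite mulrC -ler_pdivlMr// => c2.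
  have := chordD (a m (h n i)) (lam (h n i) - a m (h n i)).
  move: (n.+1%:R^-1) ml c2 => k ml c2.
  by rewrite addrC subrK -(chordN (lam _ - _)) opprB; lra.
Qed.

End limit_character.

(** * Block filters, and extension of characters along ultrafilter limits *)

(** Deletions add up under intersections, so the factor k has to depend on the
    set A; the filter is proper because blocklen n > n * blockloss n exceeds
    k * blockloss n from n = k on.  A single pass of [delete_dependent] removes no
    more than k = 1 allows. *)
Definition block_filter (X : set nat) : set_system (nat * nat) :=
  [set A | exists k : nat, forall n, (k <= n)%N -> X n ->
     exists r : seq nat, (size r <= k * blockloss n)%N /\
       forall i, (i < blocklen n)%N -> i \notin r -> A (n, i)].

Definition unbounded (X : set nat) := forall k : nat, exists2 n, (k <= n)%N & X n.

Lemma block_filter_proper (X : set nat) : unbounded X -> ProperFilter (block_filter X).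
Proof.
move=> infX; apply: Build_ProperFilter_ex.
  move=> A [k kA]; have [n kn Xn] := infX k.
  have [r [szr rA]] := kA n kn Xn.
  have [i [iL ir]] : exists i, (i < blocklen n)%N /\ i \notin r.
    apply: contrapT => nex.
    have : (size (iota 0 (blocklen n)) <= size r)%N.
      apply: uniq_leq_size; first exact: iota_uniq.
      move=> i; rewrite mem_iota add0n => /= iL; apply: contrapT => /negP ir.
      by apply: nex; exists i.
    rewrite size_iota blocklenE leqNgt => /negP; apply.
    by rewrite ltnS (leq_trans szr)// leq_mul2r kn orbT.
  by exists (n, i); exact: rA.
split.
- by exists 0%N => n _ _; exists [::].
- move=> A B [k kA] [l lB]; exists (k + l)%N => n kln Xn.
  have [|r [szr rA]] := kA n _ Xn; first by apply: leq_trans kln; rewrite leq_addr.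
  have [|q [szq qB]] := lB n _ Xn; first by apply: leq_trans kln; rewrite leq_addl.
  exists (r ++ q); split; first by rewrite size_cat mulnDl leq_add.
  move=> i iL; rewrite mem_cat negb_or => /andP[ir iq].
  by split; [exact: rA|exact: qB].
- move=> A B AB [k kA]; exists k => n kn Xn.
  have [r [szr rA]] := kA n kn Xn; exists r; split => // i iL ir.
  by apply: AB; exact: rA.
Qed.

Lemma block_filter_late (X : set nat) (k : nat) :
  block_filter X [set t | (k <= t.1)%N].
Proof. by exists k => n kn _; exists [::]. Qed.

Section extension.
Variables (R : realType) (I : choiceType) (s : I -> nat -> nat -> 'Q^(I)).
Variable p : I -> set_system (nat * nat).
Hypothesis pU : forall x, UltraFilter (p x).

Definition below (y x : I) := exists n i, y \in msupp (s x n i).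
Hypothesis below_wf : well_founded below.

(** The continuity that makes chi_x an accumulation point of the sequence s x. *)
Definition limit_at (lam : 'Q^(I) -> R) (x : I) :=
  anglim (p x) (fun t => lam (s x t.1 t.2)) (lam << 1 *g x >>).

Lemma circle_character_sum (G : zmodType) (lam : G -> R) (J : Type) (r : seq J)
    (F : J -> G) : circle_character lam ->
  chord (lam (\sum_(i <- r) F i) - \sum_(i <- r) lam (F i)) = 0.
Proof.
move=> lamC; elim: r => [|i r IH].
  rewrite !big_nil subr0; have := lamC 0 0.
  by rewrite addr0 opprD addrA subrr sub0r chordN.
rewrite !big_cons; have := chord_eq0D (lamC (F i) (\sum_(j <- r) F j)) IH.
by apply: etrans; congr chord; ring.
Qed.

Variables (D : set I) (lam0 : 'Q^(I) -> R).
Hypothesis lam0C : circle_character lam0.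

Let pP x : ProperFilter (p x). Proof. exact: (@ultra_proper _ _ (pU x)). Qed.

(** On D the angles are those of lam0; elsewhere the angle of q chi_x is the
    limit of the angles of the vectors q (s x n i).  The value 0 at q = 0 makes
    sums over supports insensitive to enlarging the support. *)
Let body (x : I) (rec : forall y, below y x -> rat -> R) (q : rat) : R :=
  if q == 0 then 0 else if pselect (D x) then lam0 << q *g x >> else
  xget 0 [set l | anglim (p x) (fun t => \sum_(y <- msupp (s x t.1 t.2))
    if pselect (below y x) is left yx then rec y yx (q * (s x t.1 t.2)@_y)
    else 0) l].

Let ang : I -> rat -> R := Fix below_wf (fun=> rat -> R) body.

Let ang_eq x : ang x = @body x (fun y _ => ang y).
Proof.
rewrite /ang Fix_eq// => y f g fg; congr body.
by apply: functional_extensionality_dep => z; apply: functional_extensionality_dep.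
Qed.

Let ang0 x : ang x 0 = 0. Proof. by rewrite ang_eq /body eqxx. Qed.

Let chord_lam00 : chord (lam0 0) = 0.
Proof.
have := circle_character_sum [::] (fun _ : unit => 0) lam0C.
by rewrite !big_nil subr0.
Qed.

Let angD x q : D x -> chord (ang x q - lam0 << q *g x >>) = 0.
Proof.
move=> Dx; rewrite ang_eq /body; have [->|_] := eqVneq q 0.
  by rewrite monalgU0 sub0r chordN.
by case: (pselect (D x)) => //= _; rewrite subrr chord0.
Qed.

Let angC x q : ~ D x -> anglim (p x)
  (fun t => \sum_(y <- msupp (s x t.1 t.2)) ang y (q * (s x t.1 t.2)@_y)) (ang x q).
Proof.
move=> Dx; have [->|q0] := eqVneq q 0.
  move=> e e0; apply: filterS filterT => t _ /=.
  by rewrite big1 ?ang0 ?subrr ?chord0// => y _; rewrite mul0r ang0.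
rewrite [ang x]ang_eq /body (negbTE q0); case: (pselect (D x)) => //= _.
rewrite (_ : (fun t => _) = (fun t => \sum_(y <- msupp (s x t.1 t.2))
    if pselect (below y x) is left _ then ang y (q * (s x t.1 t.2)@_y) else 0)).
  by apply: (@xgetPex _ 0 [set l | anglim (p x) _ l]); exact: anglim_exists.
apply/funext => t; apply: eq_big_seq => y yt.
by case: (pselect (below y x)) => //= -[]; exists t.1, t.2.
Qed.

Let ang_additive x q q' : chord (ang x (q + q') - (ang x q + ang x q')) = 0.
Proof.
elim/(well_founded_ind below_wf): x q q' => x IH q q'.
have [Dx|nDx] := pselect (D x).
  have := chord_eq0B (chord_eq0D (angD (q + q') Dx)
    (lam0C << q *g x >> << q' *g x >>)) (chord_eq0D (angD q Dx) (angD q' Dx)).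
  by rewrite -monalgUD; apply: etrans; congr chord; ring.
apply: (anglimD (pP x) _ (angC q nDx) (angC q' nDx) (angC (q + q') nDx)) => t.
rewrite -big_split /= big_seq [X in _ - X]big_seq; apply: chord_sum => y yt.
by rewrite mulrDl; apply: IH; exists t.1, t.2.
Qed.

Let lam (v : 'Q^(I)) : R := \sum_(y <- msupp v) ang y v@_y.

Let lamEw (v : 'Q^(I)) (d : {fset I}) : (msupp v `<=` d)%fset ->
  lam v = \sum_(y <- d) ang y v@_y.
Proof.
by move=> vd; apply: big_fset_incl => // y _ yv; rewrite mcoeff_outdom// ang0.
Qed.

(** An ultrafilter limit of homomorphisms is a homomorphism, so the recursion
    that defines the angle at chi_x as the required limit yields one. *)
Lemma extend_character : exists lam : 'Q^(I) -> R,
  [/\ circle_character lam,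
      forall v, {in msupp v, forall y, D y} -> chord (lam v - lam0 v) = 0 &
      forall x, ~ D x -> limit_at lam x].
Proof.
exists lam; split.
- move=> v w.
  rewrite (lamEw (msuppD_le v w)) (@lamEw v (msupp v `|` msupp w)%fset) ?fsubsetUl//.
  rewrite (@lamEw w (msupp v `|` msupp w)%fset) ?fsubsetUr// -big_split /=.
  by apply: chord_sum => y _; rewrite mcoeffD ang_additive.
- move=> v vD.
  have := circle_character_sum (msupp v) (fun y => << v@_y *g y >>) lam0C.
  rewrite -monalgE => H.
  have := chord_eq0B
    (_ : chord (lam v - \sum_(y <- msupp v) lam0 << v@_y *g y >>) = 0) H.
  rewrite opprB addrA subrK; apply.
  by rewrite /lam big_seq [X in _ - X]big_seq; apply: chord_sum => y /vD; exact: angD.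
- move=> x nDx; have := angC 1 nDx; rewrite /limit_at.
  have -> : lam << 1 *g x >> = ang x 1.
    by rewrite (lamEw msuppU_le) big_seq_fset1 mcoeffUU.
  congr anglim; apply/funext => t.
  by apply: eq_bigr => y _; rewrite mul1r.
Qed.

End extension.

(** * Enough characters with the prescribed limits *)

(** Applied to the support relation, this provides the set D outside which a
    character can be redefined without affecting the limits required inside. *)
Lemma countable_closure (I : Type) (ch : I -> set I) (F : set I) :
  (forall x, countable (ch x)) -> countable F ->
  exists D : set I, [/\ countable D, F `<=` D & forall x y, D x -> ch x y -> D y].
Proof.
move=> chc Fc.
pose fix E n : set I := if n is m.+1 then \bigcup_(x in E m) ch x else F.
exists (\bigcup_n E n); split.
- apply: bigcup_countable => // n _; elim: n => [//|n IH] /=.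
  by apply: bigcup_countable.
- by move=> x Fx; exists 0%N.
- by move=> x y [n _ nx] xy; exists n.+1 => //; exists x.
Qed.

Definition coord_angle (R : realType) (I : choiceType) (y : I) (c : rat)
  (u : 'Q^(I)) : R := pi * ratr (c * u@_y).

Lemma coord_angle_is_additive (R : realType) (I : choiceType) (y : I) (c : rat) :
  zmod_morphism (@coord_angle R I y c).
Proof. by move=> u v; rewrite /coord_angle mcoeffB !mulrBr rmorphB mulrBr. Qed.

HB.instance Definition _ (R : realType) (I : choiceType) (y : I) (c : rat) :=
  GRing.isZmodMorphism.Build 'Q^(I) R (@coord_angle R I y c)
    (@coord_angle_is_additive R I y c).

Lemma additive_separates (R : realType) (I : choiceType) (v : 'Q^(I)) :
  v != 0 -> exists lam : {additive 'Q^(I) -> R}, lam v = pi.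
Proof.
move=> v0; have [y vy] : exists y, v@_y != 0.
  apply: contrapT => nex; move/eqP: v0; apply; apply/malgP => y.
  by rewrite mcoeff0; apply/eqP; apply: contrapT => /negP vy; apply: nex; exists y.
exists (@coord_angle R I y (v@_y)^-1) => /=.
by rewrite /coord_angle mulVf// rmorph1 mulr1.
Qed.

Section separation.
Variables (R : realType) (I : choiceType) (s : I -> nat -> nat -> 'Q^(I)).
Variables (p : I -> set_system (nat * nat)) (X : I -> set nat).
Hypothesis pU : forall x, UltraFilter (p x).
Hypothesis pX : forall x, block_filter (X x) `<=` p x.
Hypothesis below_wf : well_founded (below s).
Hypothesis X_ad : forall x y, x <> y ->
  exists k, forall n, (k <= n)%N -> X x n -> ~ X y n.

Definition dissociated_blocks (x : I) :=
  forall n, dissociated (s x n) (blocklen n) (2 * blockmult n).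

(** The characters that generate the topology. *)
Definition admissible (lam : 'Q^(I) -> R) :=
  circle_character lam /\ forall x, dissociated_blocks x -> limit_at s p lam x.

Lemma circle_characterB (G : zmodType) (lam : G -> R) (v w : G) :
  circle_character lam -> chord (lam (v - w) - (lam v - lam w)) = 0.
Proof.
move=> lamC; have := lamC (v - w) w; rewrite subrK -chordN.
by apply: etrans; congr chord; ring.
Qed.

Lemma below_irrefl x : ~ below s x x.
Proof.
by elim/(well_founded_ind below_wf): x => x IH xx; apply: (IH x).
Qed.

(** Comparing coefficients at x, which is in no support, a relation between the
    shifted vectors has coefficient sum 0, so it is a relation between the
    original ones. *)
Lemma dissociated_shift (h : nat -> 'Q^(I)) (x : I) (L B : nat) :
  (forall i, x \notin msupp (h i)) -> dissociated h L B ->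
  dissociated (fun i => h i - << 1 *g x >>) L B.
Proof.
move=> hx hdis d dB sum0; apply: hdis => //.
have {}sum0 : \sum_(i <- iota 0 L) h i *~ d i =
    << 1 *g x >> *~ (\sum_(i <- iota 0 L) d i).
  apply/eqP; rewrite -subr_eq0 mulrz_sumr -sumrB; apply/eqP.
  by rewrite -[RHS]sum0; apply: eq_bigr => i _; rewrite mulrzBl.
rewrite sum0; have := congr1 (mcoeff x) sum0.
rewrite (raddf_sum (mcoeff x)) big1; last first.
  move=> i _; transitivity ((h i)@_x *~ d i); first exact: (raddfMz (mcoeff x)).
  by rewrite mcoeff_outdom// mul0rz.
rewrite (_ : (_ *~ _)@_x = (<< 1 *g x >> : 'Q^(I))@_x *~ \sum_(i <- iota 0 L) d i);
  last exact: (raddfMz (mcoeff x)).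
rewrite mcoeffUU => /esym/eqP; rewrite intr_eq0 => /eqP ->.
by rewrite mulr0z.
Qed.

(** Block n is assigned to the first x of D, in a fixed enumeration, with n in
    X x; almost disjointness leaves to each x all but finitely many n in X x.
    A character for these blocks exists by [limit_character], and
    [extend_character] corrects it outside D without changing it at v. *)
Lemma admissible_separates (v : 'Q^(I)) : v != 0 ->
  exists2 lam : 'Q^(I) -> R, admissible lam & chord (lam v) != 0.
Proof.
move=> v0.
have [D [Dc vD Dcl]] : exists D : set I,
    [/\ countable D, [set` msupp v] `<=` D & forall x y, D x -> below s y x -> D y].
  apply: (countable_closure (ch := fun x y => below s y x)) => // x.
  rewrite (_ : (fun y => _) = \bigcup_n \bigcup_i [set` msupp (s x n i)]).
    by apply: bigcup_countable => // n _; apply: bigcup_countable.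
  apply/seteqP; split => [y [n [i yni]]|y [n _ [i _ yni]]]; last by exists n, i.
  by exists n => //; exists i.
have [f finj] := countable_injP _ Dc.
pose own n x := [/\ D x, X x n & forall y, D y -> X y n -> (f x <= f y)%N].
have own_uniq : forall n x y, own n x -> own n y -> x = y.
  move=> n x y [Dx Xx xmin] [Dy Xy ymin]; apply: finj; rewrite ?inE//.
  by apply/eqP; rewrite eqn_leq xmin//= ymin.
have own_late : forall x, D x -> exists k, forall n, (k <= n)%N -> X x n -> own n x.
  move=> x Dx.
  have [k kP] : exists k, forall y, D y -> (f y < f x)%N ->
      x <> y -> forall n, (k <= n)%N -> X x n -> ~ X y n.
    elim: {1}(f x) => [|m [k kP]]; first by exists 0%N.
    have [[y [Dy fym xy]]|nex] := pselect (exists y, [/\ D y, f y = m & x <> y]).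
      have [l lP] := X_ad xy; exists (maxn k l) => z Dz; rewrite ltnS leq_eqVlt.
      case/orP => [/eqP fzm _ n|zm xz n]; rewrite geq_max => /andP[kn ln].
        have -> : z = y by apply: finj; rewrite ?inE// fzm fym.
        exact: lP.
      exact: kP.
    exists k => z Dz; rewrite ltnS leq_eqVlt => /orP[/eqP fzm xz|]; last exact: kP.
    by exfalso; apply: nex; exists z.
  exists k => n kn Xn; split => // y Dy Xy; rewrite leqNgt; apply/negP => yx.
  apply: (kP y Dy yx _ n kn Xn Xy) => xy.
  by move: yx; rewrite xy ltnn.
have [y0 _] : exists y, v@_y != 0.
  apply: contrapT => nex; move/eqP: v0; apply; apply/malgP => y.
  by rewrite mcoeff0; apply/eqP; apply: contrapT => /negP vy; apply: nex; exists y.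
have /choice[c cP] : forall n, exists x, forall y, own n y -> x = y.
  move=> n; have [[y yn]|nex] := pselect (exists y, own n y).
    by exists y => z zn; apply: own_uniq yn zn.
  by exists y0 => z zn; exfalso; apply: nex; exists z.
pose h n i := s (c n) n i - << 1 *g c n >>.
have [|lam0 [rem [lam0C lam0v szr lam0h]]] :=
    @limit_character R _ v h (fun n => dissociated_blocks (c n))
      (@additive_separates R I) v0.
  move=> n gn; apply: dissociated_shift => // i; apply/negP => xi.
  by apply: (@below_irrefl (c n)); exists n, i.
have [lam [lamC lamD lamL]] := extend_character pU below_wf D lam0C.
exists lam; last first.
  have := lamD v (fun y yv => vD y yv) => H.
  by rewrite (chord_congr H).
split => // x gx; have [Dx|] := pselect (D x); last exact: lamL.
have [k kP] := own_late x Dx.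
move=> e e0.
have [m mP] : exists m, forall n, (m <= n)%N -> 6 / n.+1%:R < e.
  exists (Num.truncn (6 / e)) => n mn; rewrite ltr_pdivrMr ?ltr0n// mulrC.
  rewrite -ltr_pdivrMr//; apply: (lt_le_trans (truncnS_gt _)).
  by rewrite ler_nat.
apply: pX; exists (maxn (maxn k m) 1) => n.
rewrite !geq_max => /andP[/andP[kn mn] n1] Xn.
have cnx : c n = x by apply: cP; exact: kP.
exists (rem n); split; first by rewrite (leq_trans (szr n))// leq_pmull// !leq_max orbT.
move=> i iL ir /=; have := lam0h n i; rewrite /h cnx => /(_ gx iL ir) le.
apply: le_lt_trans (mP n mn); apply: le_trans le.
have sD y : y \in msupp (s x n i) -> D y by move=> yi; apply: Dcl Dx _; exists n, i.
have xD y : y \in msupp (<< 1 *g x >> : 'Q^(I)) -> D y.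
  by move/(fsubsetP msuppU_le); rewrite inE => /eqP ->.
have E : chord (lam (s x n i) - lam << 1 *g x >> -
    lam0 (s x n i - << 1 *g x >>)) = 0.
  have := chord_eq0B (chord_eq0B (lamD _ sD) (lamD _ xD))
    (circle_characterB (s x n i) << 1 *g x >> lam0C).
  by apply: etrans; congr chord; ring.
by rewrite (chord_congr E).
Qed.
End separation.

(** * The group topology of a set of characters *)

Section character_topology.
Variables (R : realType) (G : zmodType) (H : set (G -> R)).
Hypothesis HC : forall lam, H lam -> circle_character lam.

(** Finite sums of chords of characters: a directed family, so that basic
    neighbourhoods need a single function.  Gauges satisfy the triangle
    inequality up to a factor 2. *)
Inductive gauge : (G -> R) -> Prop :=
| gauge0 : gauge (fun=> 0)
| gaugeS lam q : H lam -> gauge q -> gauge (fun v => chord (lam v) + q v).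

Lemma gauge_ge0 q v : gauge q -> 0 <= q v.
Proof. by elim=> // lam q' _ _ q0; rewrite addr_ge0 ?chord_ge0. Qed.

Lemma gauge_eq0 q : gauge q -> q 0 = 0.
Proof.
elim=> // lam q' /HC lamC _ ->; rewrite addr0.
by have := circle_characterB 0 0 lamC; rewrite !subrr subr0.
Qed.

Lemma gaugeN q v : gauge q -> q (- v) = q v.
Proof.
elim=> // lam q' /HC lamC _ ->; congr (_ + _).
have := lamC v (- v); rewrite subrr => /(chord_eq0B _) E.
have E0 : chord (lam 0) = 0.
  by have := circle_characterB 0 0 lamC; rewrite !subrr subr0.
rewrite -[RHS]chordN; apply: chord_congr; have := E _ E0.
by apply: etrans; congr chord; ring.
Qed.

Lemma gaugeD q v w : gauge q -> q (v + w) <= 2 * (q v + q w).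
Proof.
elim=> [|lam q' /HC lamC _ IH]; first lra.
have := chordD (lam v) (lam w).
have -> : chord (lam v + lam w) = chord (lam (v + w)).
  by apply/esym/chord_congr/lamC.
lra.
Qed.

Lemma gauge_directed q q' : gauge q -> gauge q' ->
  exists r, [/\ gauge r, forall v, q v <= r v & forall v, q' v <= r v].
Proof.
move=> gq gq'; elim: gq => [|lam r Hlam _ [r' [gr' rr' qr']]].
  by exists q'; split => // v; exact: gauge_ge0.
exists (fun v => chord (lam v) + r' v); split; first exact: gaugeS.
- by move=> v; rewrite lerD2l.
- by move=> v; rewrite (le_trans (qr' v))// lerDr chord_ge0.
Qed.

Definition gauge_open (U : set G) := forall x, U x ->
  exists q e, [/\ gauge q, 0 < e & forall y, q (y - x) < e -> U y].

Lemma gauge_openT : gauge_open setT.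
Proof. by move=> x _; exists (fun=> 0), 1; split => //; exact: gauge0. Qed.

Lemma gauge_openI : setI_closed gauge_open.
Proof.
move=> U V oU oV x [Ux Vx].
have [q [e [gq e0 qU]]] := oU x Ux; have [r [d [gr d0 rV]]] := oV x Vx.
have [t [gt qt rt]] := gauge_directed gq gr.
exists t, (Order.min e d); split => //; first by rewrite lt_min e0.
by move=> y; rewrite lt_min => /andP[te td]; split;
  [apply: qU; apply: le_lt_trans te|apply: rV; apply: le_lt_trans td].
Qed.

Lemma gauge_open_bigU (J : Type) (f : J -> set G) :
  (forall i, gauge_open (f i)) -> gauge_open (\bigcup_i f i).
Proof.
move=> fo x [i _ fx]; have [q [e [gq e0 qf]]] := fo i x fx.
by exists q, e; split => // y /qf; exists i.
Qed.

Definition gauge_topology : topology_on G :=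
  TopologyOn gauge_openT gauge_openI gauge_open_bigU.

Local Notation T := (with_topology gauge_topology).

(** The points around which A contains a gauge ball form an open set: because of
    the factor in [gaugeD], a quarter of the radius serves for nearby points. *)
Lemma gauge_nbhsP (x : T) (A : set T) : nbhs x A <->
  exists q e, [/\ gauge q, 0 < e & forall y : T, q (y - x) < e -> A y].
Proof.
split.
  rewrite nbhsE => -[U [oU Ux] UA]; have [q [e [gq e0 qU]]] := oU x Ux.
  by exists q, e; split => // y /qU /UA.
move=> [q [e [gq e0 qA]]]; rewrite nbhsE.
exists [set y : T | exists r d,
    [/\ gauge r, 0 < d & forall z : T, r (z - y) < d -> A z]].
  split; last by exists q, e.
  move=> y [r [d [gr d0 rA]]]; exists r, (d / 4); split => //; first by lra.
  move=> z ryz; exists r, (d / 4); split => //; first by lra.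
  move=> w rzw; apply: rA; have := gaugeD (w - z) (z - y) gr.
  by rewrite addrA subrK; lra.
by move=> y [r [d [gr d0 rA]]]; apply: rA; rewrite subrr gauge_eq0.
Qed.

Lemma gauge_group_topology : group_topology gauge_topology.
Proof.
split.
  move=> [x y] A /= /gauge_nbhsP [q [e [gq e0 qA]]].
  have e4 : 0 < e / 4 by lra.
  exists ([set z : T | q (z - x) < e / 4], [set z : T | q (z - y) < e / 4]).
    by split; apply/gauge_nbhsP; exists q, (e / 4).
  move=> [z w] [/= zx wy]; apply: qA => /=; have := gaugeD (z - x) (w - y) gq.
  by rewrite addrACA -opprD; lra.
move=> x A /= /gauge_nbhsP [q [e [gq e0 qA]]].
apply/gauge_nbhsP; exists q, e; split => // y yx; apply: qA.
by rewrite -opprD gaugeN.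
Qed.

Hypothesis Hsep : forall v, v != 0 -> exists2 lam, H lam & chord (lam v) != 0.

Lemma gauge_separates (v : G) : v != 0 -> exists2 q, gauge q & 0 < q v.
Proof.
move=> /Hsep[lam Hlam lamv]; exists (fun v => chord (lam v) + 0).
  by apply: gaugeS => //; exact: gauge0.
by rewrite addr0 lt_neqAle eq_sym lamv chord_ge0.
Qed.

Lemma gauge_hausdorff : hausdorff_space T.
Proof.
move=> x y cxy; apply: contrapT => /eqP; rewrite -subr_eq0 => /gauge_separates[q gq q0].
have [||z [/= zx zy]] := cxy [set z : T | q (z - x) < q (x - y) / 4]
    [set z : T | q (z - y) < q (x - y) / 4].
- by apply/gauge_nbhsP; exists q, (q (x - y) / 4); split => //; lra.
- by apply/gauge_nbhsP; exists q, (q (x - y) / 4); split => //; lra.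
have := gaugeD (x - z) (z - y) gq; rewrite addrA subrK -(gaugeN (x - z) gq) opprB.
lra.
Qed.

(** Convergence tested on characters is convergence in the topology. *)
Lemma gauge_anglim (S : Type) (p : set_system S) (a : S -> G) (x : T) (A : set T) :
  Filter p -> (forall lam, H lam -> anglim p (lam \o a) (lam x)) ->
  nbhs x A -> p [set t | A (a t)].
Proof.
move=> pF alim /gauge_nbhsP [q [e [gq e0 qA]]].
suff : p [set t | q (a t - x) < e] by apply: filterS => t; exact: qA.
elim: gq e e0 {qA} => [|lam r Hlam gr IH] e e0.
  by apply: filterS filterT => t _.
have e2 : 0 < e / 2 by lra.
apply: filterS (filterI (alim lam Hlam _ e2) (IH _ e2)) => t [/= + rt].
rewrite -(chord_congr (circle_characterB (a t) x (HC Hlam))).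
lra.
Qed.

End character_topology.

(** * Dissociated blocks in a sequence *)

Lemma finitely_many_combinations (G : zmodType) (h : nat -> G) (r : seq nat) (B : nat) :
  exists T : seq G, forall d : nat -> int, (forall i, (`|d i| <= B)%N) ->
    \sum_(i <- r) h i *~ d i \in T.
Proof.
elim: r => [|x r [T TP]].
  by exists [:: 0] => d _; rewrite big_nil mem_head.
exists [seq h x *~ (j%:Z - B%:Z) + t | j <- iota 0 (2 * B).+1, t <- T] => d dB.
rewrite big_cons; apply/allpairsP; exists (absz (d x + B%:Z), \sum_(i <- r) h i *~ d i).
split; [|exact: TP|].
- by rewrite mem_iota /fst; have := dB x; lia.
- by rewrite /fst /snd; congr (_ *~ _ + _); have := dB x; lia.
Qed.

Lemma eventually_notin (T : eqType) (u : nat -> T) (l : seq T) :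
  (forall v, exists k, forall n, (k <= n)%N -> u n <> v) ->
  exists k, forall n, (k <= n)%N -> u n \notin l.
Proof.
move=> uE; elim: l => [|v l [k kP]]; first by exists 0%N.
have [m mP] := uE v; exists (maxn k m) => n; rewrite geq_max => /andP[kn mn].
by rewrite in_cons negb_or kP// andbT; apply/eqP/mP.
Qed.

(** Adding a vector w to a dissociated block keeps it dissociated unless c w is
    one of finitely many combinations for some bounded c <> 0; as V is
    torsion-free this excludes finitely many w, and u leaves every finite set. *)
Lemma dissociated_block (I : choiceType) (u : nat -> 'Q^(I)) (n L B : nat) :
  (forall v, exists k, forall m, (k <= m)%N -> u m <> v) ->
  exists k : nat -> nat, (forall i, (n <= k i)%N) /\ dissociated (u \o k) L B.
Proof.
move=> uE; elim: L => [|L [k [kn kd]]]; first by exists (fun=> n); split.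
have [T TP] := finitely_many_combinations (u \o k) (iota 0 L) B.
have [m mP] := eventually_notin
  [seq - ((j%:Z - B%:Z)%:~R^-1 *: t) | j <- iota 0 (2 * B).+1, t <- T] uE.
pose N := maxn m n; pose k' i := if i == L then N else k i.
exists k'; split; first by move=> i; rewrite /k'; case: ifP; rewrite // leq_maxr.
move=> d dB; rewrite -addn1 iotaD big_cat /= big_seq1 /k' add0n eqxx.
have -> : \sum_(i <- iota 0 L) u (if i == L then N else k i) *~ d i =
    \sum_(i <- iota 0 L) (u \o k) i *~ d i.
  by apply: eq_big_seq => i; rewrite mem_iota /= add0n => /ltn_eqF ->.
have [dL|dL] := eqVneq (d L) 0.
  rewrite dL mulr0z addr0 => sum0 i; rewrite addn1 ltnS leq_eqVlt.
  by case/orP => [/eqP ->//|]; apply: kd.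
move=> /eqP; rewrite addrC addr_eq0 => /eqP E.
have := mP N (leq_maxl _ _); rewrite (_ : u N = - ((d L)%:~R^-1 *:
    \sum_(i <- iota 0 L) (u \o k) i *~ d i)); last first.
  by rewrite -scalerN -E -scaler_int scalerA mulVf ?scale1r// intr_eq0.
have -> : d L = (absz (d L + B%:Z))%:Z - B%:Z by have := dB L; lia.
rewrite (allpairs_f (fun j t => - ((j%:Z - B%:Z)%:~R^-1 *: t)))//; last exact: TP.
by rewrite mem_iota; have := dB L; lia.
Qed.

(** * Index sets of the size of the continuum *)

Lemma injective_card_le (T U : Type) (f : T -> U) :
  injective f -> [set: T] #<= [set: U].
Proof.
move=> finj; have fE : f @` setT #= [set: T].
  by apply: inj_card_eq => x y _ _; exact: finj.
by rewrite -(card_le_eql fE) subset_card_le.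
Qed.

Lemma card_eq_bijection (T U : Type) : [set: T] #= [set: U] ->
  exists f : T -> U, bijective f.
Proof.
move=> /card_bijP[f [g fg gf]].
exists (fun x => val (f (to_setT x))), (fun y => val (g (to_setT y))) => x.
- rewrite (_ : to_setT (val _) = f (to_setT x)) ?fg//; exact: val_inj.
- rewrite (_ : to_setT (val _) = g (to_setT x)) ?gf//; exact: val_inj.
Qed.

Lemma countable_functions_card (K A : countType) :
  [set: K -> A] #<= [set: nat -> bool].
Proof.
apply: (@injective_card_le _ _ (fun (f : K -> A) (n : nat) =>
  if choice.unpickle n is Some (k, a) then f k == a else false)).
move=> f g fg; apply/funext => k.
have := congr1 (fun h : nat -> bool => h (choice.pickle (k, f k))) fg.
by rewrite /= choice.pickleK eqxx => /esym/eqP.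
Qed.

(** A node stores a double sequence of finite formal rational combinations of its
    subtrees: a (n, i) lists coefficients and numbers of subtrees.  Well-foundedness
    of the subtree relation is what ordinal enumerations usually provide.  The
    label b makes two nodes for each sequence. *)
Inductive tree := Leaf
  | Node (b : bool) (a : nat * nat -> seq (rat * nat)) (t : nat -> tree).

(** A tree is determined by the labels found along the finite paths from its
    root, which embeds trees into functions between countable types. *)
Fixpoint tree_code (t : tree) (w : seq nat * (nat * nat)) :
    option (bool * seq (rat * nat)) :=
  match t, w.1 with
  | Leaf, _ => None
  | Node b a _, [::] => Some (b, a w.2)
  | Node _ _ t', m :: w' => tree_code (t' m) (w', w.2)
  end.

Lemma tree_code_inj : injective tree_code.
Proof.
elim=> [|b a t IH] [|b' a' t'] E //.
- by have := congr1 (fun f => f ([::], (0, 0)%N)) E.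
- by have := congr1 (fun f => f ([::], (0, 0)%N)) E.
have E0 n : (b, a n) = (b', a' n).
  by have /= [-> ->] := congr1 (fun f => f ([::], n)) E.
have [-> _] := E0 (0, 0)%N; congr Node.
  by apply/funext => n; case: (E0 n).
apply/funext => m; apply: IH; apply/funext => -[w n].
exact: (congr1 (fun f => f (m :: w, n)) E).
Qed.

Lemma card_tree : [set: tree] #= [set: nat -> bool].
Proof.
rewrite card_eq_le; apply/andP; split.
  apply: card_le_trans (injective_card_le tree_code_inj) _.
  exact: countable_functions_card.
apply: (@injective_card_le _ _ (fun f : nat -> bool =>
  Node false (fun n => if f n.1 then [:: (0, 0%N)] else [::]) (fun=> Leaf))).
move=> f g [/(congr1 (fun h => h (_, 0%N))) fg]; apply/funext => n.
by have := fg n; rewrite /=; case: (f n); case: (g n).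
Qed.

Lemma msupp_sum (I : choiceType) (J : eqType) (r : seq J) (F : J -> 'Q^(I)) (y : I) :
  y \in msupp (\sum_(j <- r) F j) -> exists j, y \in msupp (F j).
Proof.
elim: r => [|j r IH]; first by rewrite big_nil msupp0 inE.
rewrite big_cons => /(fsubsetP (msuppD_le _ _)); rewrite inE => /orP[yj|/IH//].
by exists j.
Qed.

(** I is identified with the set of trees.  Any double sequence in 'Q^(I) involves
    countably many basis vectors, so it is stored at some node. *)
Lemma limit_scheme (I : choiceType) : [set: I] #= [set: nat -> bool] ->
  exists s : I -> nat -> nat -> 'Q^(I), well_founded (below s) /\
    forall g, exists x y, [/\ x <> y, s x = g & s y = g].
Proof.
move=> cardI.
have [e [e' eK e'K]] : exists e : I -> tree, bijective e.
  apply: card_eq_bijection; apply: card_eq_trans cardI _.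
  by rewrite card_eq_sym card_tree.
pose s x n i : 'Q^(I) := if e x is Node _ a t then
  \sum_(c <- a (n, i)) << c.1 *g e' (t c.2) >> else 0.
exists s; split.
  suff H t : forall x, e x = t -> Acc (below s) x by move=> x; exact: (H (e x)).
  elim: t => [|b a t IH] x ex; constructor => y [n [i]]; rewrite /s ex.
    by rewrite msupp0 inE.
  move=> /msupp_sum[c] /(fsubsetP msuppU_le); rewrite inE => /eqP ->.
  by apply: (IH c.2); rewrite e'K.
move=> g; pose x0 := e' Leaf.
pose t k := if choice.unpickle k is Some (n, i, j)
  then e (nth x0 (msupp (g n i)) j) else Leaf.
pose a (ni : nat * nat) : seq (rat * nat) := let v := g ni.1 ni.2 in
  [seq (v@_(nth x0 (msupp v) j), choice.pickle (ni.1, ni.2, j)) |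
     j <- index_iota 0 (size (msupp v))].
have sE b : s (e' (Node b a t)) = g.
  apply/funext => n; apply/funext => i; rewrite /s e'K /a big_map.
  rewrite [RHS]monalgE (big_nth x0); apply: eq_bigr => j _.
  by rewrite /t /= choice.pickleK eK.
exists (e' (Node false a t)), (e' (Node true a t)); split; rewrite ?sE//.
by move/(can_inj e'K).
Qed.

(** The first k bits of x in binary notation, after a leading 1. *)
Fixpoint prefix_code (x : nat -> bool) (k : nat) : nat :=
  if k is m.+1 then ((prefix_code x m).*2 + x m)%N else 1%N.

Lemma prefix_code_gt x k : (k < prefix_code x k)%N.
Proof. by elim: k => //= k IH; lia. Qed.

Lemma prefix_code_inj x y k l : prefix_code x k = prefix_code y l ->
  k = l /\ forall j, (j < k)%N -> x j = y j.
Proof.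
elim: k l => [|k IH] [|l] //=.
- by have := prefix_code_gt y l; case: (y l); lia.
- by have := prefix_code_gt x k; case: (x k); lia.
move=> E; have xy : x k = y l by move: E; case: (x k); case: (y l); lia.
have [|kl kP] := IH l; first by move: E; rewrite xy; lia.
split=> [|j]; first by rewrite kl.
by rewrite ltnS leq_eqVlt => /orP[/eqP ->|/kP//]; rewrite xy kl.
Qed.

(** The branches of the binary tree, as sets of codes of nodes. *)
Lemma almost_disjoint_family (I : Type) : [set: I] #= [set: nat -> bool] ->
  exists X : I -> set nat, (forall x, unbounded (X x)) /\
    forall x y, x <> y -> exists k, forall n, (k <= n)%N -> X x n -> ~ X y n.
Proof.
move=> /card_eq_bijection[b /bij_inj binj].
exists (fun x => range (prefix_code (b x))); split.
  move=> x k; exists (prefix_code (b x) k); last by exists k.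
  exact: ltnW (prefix_code_gt _ _).
move=> x y xy; have [j bj] : exists j, b x j <> b y j.
  apply: contrapT => nex; apply: xy; apply: binj; apply/funext => j.
  by apply: contrapT => bj; apply: nex; exists j.
exists (prefix_code (b x) j).+1 => n jn [k _ kn] [l _ ln].
have [kl kP] := prefix_code_inj (etrans kn (esym ln)).
move: jn; rewrite -kn => jk; case: (ltnP j k) => [/kP//|kj].
suff : (prefix_code (b x) k <= prefix_code (b x) j)%N by lia.
rewrite -(subnK kj); elim: (j - k)%N => // m IH.
by rewrite addSn /=; lia.
Qed.

(** * The countably compact topology *)

(** The n-th term is chosen outside the first n members of the cover. *)
Lemma uncovered_sequence (T : topologicalType) (J : choiceType) (D : set J)
    (f : J -> set T) : countable D -> ~ finite_subset_cover D f [set: T] ->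
  exists u : nat -> T, forall i, D i -> exists k, forall n, (k <= n)%N -> ~ f i (u n).
Proof.
move=> /countable_injP[c cinj] ncov.
have fin n : exists F : {fset J}, {subset F <= D} /\
    forall i, D i -> (c i < n)%N -> i \in F.
  elim: n => [|n [F [FD FP]]]; first by exists fset0; split => // i; rewrite inE.
  have [[i [Di cin]]|nex] := pselect (exists i, D i /\ c i = n).
    exists (i |` F)%fset; split.
      by move=> j; rewrite !inE => /orP[/eqP ->|/FD]; rewrite ?inE.
    move=> j Dj; rewrite ltnS leq_eqVlt !inE => /orP[/eqP cj|/(FP j Dj) ->].
      by rewrite (cinj j i) ?inE ?eqxx// cj.
    by rewrite orbT.
  exists F; split => // j Dj; rewrite ltnS leq_eqVlt => /orP[/eqP cj|]; last exact: FP.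
  by exfalso; apply: nex; exists j.
have /choice[u uP] : forall n, exists x : T, forall i, D i -> (c i < n)%N -> ~ f i x.
  move=> n; have [F [FD FP]] := fin n.
  apply: contrapT => nex; apply: ncov; exists F => // x _.
  apply: contrapT => nx; apply: nex; exists x => i Di ci fx; apply: nx.
  by exists i => //; exact: FP.
exists u => i Di; exists (c i).+1 => n cn; exact: uP.
Qed.

(** For a cover without finite subcover, a sequence that eventually leaves each
    member takes no value infinitely often, so blocks of it accumulate at some
    chi_x; the member around chi_x contradicts the choice of the sequence.
    A convergent sequence that is not eventually constant has a subsequence
    avoiding its limit l; blocks of it accumulate at two points chi_x, one of
    which is not l. *)
Lemma countably_compact_topology_exists (R : realType) (I : choiceType) :
  [set: I] #= [set: nat -> bool] ->
  exists tau : topology_on 'Q^(I),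
    [/\ group_topology tau,
        hausdorff_space (with_topology tau),
        countably_compact [set: with_topology tau] &
        forall (u : nat -> with_topology tau) (l : with_topology tau),
          u @ \oo --> l -> eventually_constant u].
Proof.
move=> cardI.
have [s [swf scov]] := limit_scheme cardI.
have [X [Xinf Xad]] := almost_disjoint_family cardI.
have /choice[p pP] : forall x, exists p : set_system (nat * nat),
    UltraFilter p /\ block_filter (X x) `<=` p.
  by move=> x; apply: ultraFilterLemma; exact: block_filter_proper.
have pU x : UltraFilter (p x) by case: (pP x).
have pX x : block_filter (X x) `<=` p x by case: (pP x).
have pF x : Filter (p x).
  by have pr : ProperFilter (p x) := @ultra_proper _ _ (pU x); exact: _.
pose H : set ('Q^(I) -> R) := admissible s p.
have HC lam : H lam -> circle_character lam by case.
have Hsep v : v != 0 -> exists2 lam, H lam & chord (lam v) != 0.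
  exact: admissible_separates.
pose tau := gauge_topology H.
have limP x (A : set (with_topology tau)) : dissociated_blocks s x ->
    nbhs (<< 1 *g x >> : with_topology tau) A -> p x [set t | A (s x t.1 t.2)].
  by move=> gx; apply: (gauge_anglim HC) => lam [_ lamL]; exact: lamL.
have subseq (u : nat -> 'Q^(I)) :
    (forall v, exists k, forall m, (k <= m)%N -> u m <> v) ->
    exists k : nat -> nat -> nat, (forall n i, (n <= k n i)%N) /\
      forall x, s x = (fun n i => u (k n i)) -> dissociated_blocks s x.
  move=> uE.
  have /choice[k kP] := fun n => dissociated_block n (blocklen n) (2 * blockmult n) uE.
  by exists k; split => [n|x sx n]; [|rewrite sx]; have [] := kP n.
exists tau; split.
- exact: gauge_group_topology.
- exact: gauge_hausdorff.
- move=> J D f Dc fo cov; apply: contrapT => ncov.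
  have [u uP] := uncovered_sequence Dc ncov.
  have [|k [kn kgood]] := subseq u.
    move=> v; have [i Di fiv] := cov v Logic.I.
    by have [k kP] := uP i Di; exists k => m /kP fm um; apply: fm; rewrite um.
  have [x [_ [_ sx _]]] := scov (fun n i => u (k n i)).
  have [i Di fix_] := cov << 1 *g x >> Logic.I.
  have fnbhs : nbhs (<< 1 *g x >> : with_topology tau) (f i).
    by apply: open_nbhs_nbhs; split => //; exact: fo.
  have [m mP] := uP i Di.
  have pr : ProperFilter (p x) := @ultra_proper _ _ (pU x).
  have [[n j] [/= fnj mn]] := filter_ex
    (filterI (limP x _ (kgood x sx) fnbhs) (pX x _ (@block_filter_late (X x) m))).
  by apply: (mP (k n j)); [exact: leq_trans mn (kn n j)|move: fnj; rewrite sx].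
- move=> u l ul; apply: contrapT => nconst.
  have uninf m : exists n, (m <= n)%N /\ u n <> l.
    apply: contrapT => nex; apply: nconst; exists l; exists m => // n /= mn.
    by apply: contrapT => unl; apply: nex; exists n.
  have /choice[r rP] := uninf.
  have [|k [kn kgood]] := subseq (u \o r).
    move=> v; have [->|vl] := eqVneq v l.
      by exists 0%N => m _; have [] := rP m.
    have vl0 : v - l != 0 by rewrite subr_eq0.
    have [q gq q0] := gauge_separates Hsep vl0.
    have /ul[m _ mP] : nbhs l [set y : with_topology tau | q (y - l) < q (v - l)].
      by apply/gauge_nbhsP => //; exists q, (q (v - l)).
    exists m => n mn /= urv; have := mP (r n).
    rewrite /= urv ltxx; have [rn _] := rP n.
    by move=> /(_ (leq_trans mn rn)).
  have [x [y [xy sx sy]]] := scov (fun n i => (u \o r) (k n i)).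
  (* chi_x and chi_y differ, so one of them is not l *)
  have [z [sz zl]] : exists z, s z = (fun n i => (u \o r) (k n i)) /\
      << 1 *g z >> - l != 0 :> 'Q^(I).
    have [xl|xl] := eqVneq (<< 1 *g x >> : 'Q^(I)) l; last first.
      by exists x; rewrite subr_eq0.
    exists y; split => //; rewrite subr_eq0 -xl; apply/eqP => E.
    by have := congr1 (mcoeff x) E; rewrite !mcoeffU eqxx; case: eqP => // /esym.
  have [q gq q0] := gauge_separates Hsep zl.
  have pr : ProperFilter (p z) := @ultra_proper _ _ (pU z).
  have q4 : 0 < q (<< 1 *g z >> - l) / 4 by lra.
  have /ul[m _ mP] : nbhs l
      [set w : with_topology tau | q (w - l) < q (<< 1 *g z >> - l) / 4].
    by apply/gauge_nbhsP => //; exists q, (q (<< 1 *g z >> - l) / 4).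
  have zn : nbhs (<< 1 *g z >> : with_topology tau)
      [set w : with_topology tau | q (w - << 1 *g z >>) < q (<< 1 *g z >> - l) / 4].
    by apply/gauge_nbhsP => //; exists q, (q (<< 1 *g z >> - l) / 4).
  have [[n j] [/= qnj mn]] := filter_ex
    (filterI (limP z _ (kgood z sz) zn) (pX z _ (@block_filter_late (X z) m))).
  have [rk _] := rP (k n j).
  have := mP _ (leq_trans mn (leq_trans (kn n j) rk)).
  move: qnj; rewrite sz /=; set w := u _ => wz wl.
  have := gaugeD HC (<< 1 *g z >> - w) (w - l) gq.
  by rewrite addrA subrK -(gaugeN HC (_ - w) gq) opprB; lra.
Qed.

(** * A Hamel basis of the size of the continuum *)

(** Dedekind cuts. *)
Lemma card_real_le (R : realType) : [set: R] #<= [set: nat -> bool].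
Proof.
apply: card_le_trans (countable_functions_card rat bool).
apply: (@injective_card_le _ _ (fun (x : R) (q : rat) => ratr q < x)) => x y xy.
wlog xlty : x y xy / x < y.
  by move=> W; have [xy'|xy'|//] := ltgtP x y; [exact: W|apply/esym; exact: W].
have [q /=] := rat_in_itvoo xlty; rewrite in_itv /= => /andP[xq qy].
by have := congr1 (fun h => h q) xy; rewrite qy ltNge ltW.
Qed.

Section factorial_series.
Variables (R : realType) (X : set nat).

Definition fact_sum (N : nat) : R := \sum_(0 <= n < N) `[< X n >]%:R / n`!%:R.

Lemma fact_sumS N : fact_sum N.+1 = fact_sum N + `[< X N >]%:R / N`!%:R.
Proof. by rewrite /fact_sum big_nat_recr. Qed.

Lemma fact_sum_int N : (N`!%:R * fact_sum N.+1) \is a Num.int.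
Proof.
elim: N => [|N IH].
  by rewrite /fact_sum big_nat1 fact0 mul1r divr1; case: asboolP.
have f0 : N.+1`!%:R != 0 :> R by rewrite pnatr_eq0 -lt0n fact_gt0.
rewrite fact_sumS mulrDr mulrCA mulfV// mulr1; apply: rpredD; last exact: natr_int.
by rewrite factS natrM -mulrA; apply: rpredM; first exact: natr_int.
Qed.

(** The sums increase and the upper bounds on the right decrease, since
    1/N! + 2/(N+1)! <= 2/N! for N > 0. *)
Lemma fact_sum_approx : exists a : R, forall N, (0 < N)%N ->
  fact_sum N <= a <= fact_sum N + 2 / N`!%:R.
Proof.
have up N : fact_sum N <= fact_sum N.+1 by rewrite fact_sumS lerDl divr_ge0.
have upD N M : fact_sum N <= fact_sum (M + N).
  by elim: M => // M IH; rewrite addSn (le_trans IH).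
have down N : (0 < N)%N ->
    fact_sum N.+1 + 2 / N.+1`!%:R <= fact_sum N + 2 / N`!%:R.
  move=> N0; have f0 : (0 : R) < N`!%:R by rewrite ltr0n fact_gt0.
  rewrite fact_sumS factS natrM -addrA lerD2l invfM mulrA -mulrDl.
  rewrite ler_pM2r ?invr_gt0//.
  have : 2 / N.+1%:R <= 1 :> R by rewrite ler_pdivrMr ?ltr0n// mul1r ler_nat.
  have : `[< X N >]%:R <= 1 :> R by rewrite lern1 leq_b1.
  move: (_%:R) (2 / _) => b t; lra.
have downD N M : (0 < N)%N ->
    fact_sum (M + N) + 2 / (M + N)`!%:R <= fact_sum N + 2 / N`!%:R.
  move=> N0; elim: M => // M IH; rewrite addSn (le_trans _ IH)// down//.
  by rewrite addn_gt0 N0 orbT.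
have ub N M : (0 < N)%N -> fact_sum M <= fact_sum N + 2 / N`!%:R.
  move=> N0; rewrite (le_trans (upD M N))// addnC (le_trans _ (downD N M N0))//.
  by rewrite lerDl divr_ge0.
exists (sup (range fact_sum)) => N N0; apply/andP; split.
  apply: ub_le_sup; last by exists N.
  by exists (fact_sum 1 + 2 / 1`!%:R) => _ [M _ <-]; exact: ub.
by apply: ge_sup; [exists (fact_sum 0), 0%N|move=> _ [M _ <-]; exact: ub].
Qed.

End factorial_series.

Lemma common_denominator (r : seq rat) : exists2 d : nat, (0 < d)%N &
  {in r, forall q, q * d%:R \is a Num.int}.
Proof.
elim: r => [|q r [d d0 dP]]; first by exists 1%N.
have eqd : (absz (denq q))%:R = (denq q)%:~R :> rat.
  by rewrite -[denq q in RHS]absz_denq.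
exists (absz (denq q) * d)%N.
  by rewrite muln_gt0 d0 absz_gt0 denq_neq0.
move=> x; rewrite in_cons natrM => /orP[/eqP ->|/dP xd].
  by rewrite mulrA eqd -numqE; apply: rpredM; [exact: intr_int|exact: natr_int].
by rewrite mulrCA; apply: rpredM => //; exact: natr_int.
Qed.

(** The irrationality proof for e.  Clear denominators in a relation and replace
    the series by their partial sums up to 1/N!: the result becomes an integer when
    multiplied by N!, and it is too small, being equal to the combination of the
    remainders, not to vanish for large N.  So all late terms of the combined
    series vanish, but for large n in X y0 the n-th term is the coefficient of y0
    divided by n!. *)
Lemma independent_reals (R : realType) (I : choiceType) :
  [set: I] #= [set: nat -> bool] ->
  exists a : I -> R, forall v : 'Q^(I),
    \sum_(y <- msupp v) ratr v@_y * a y = 0 -> v = 0.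
Proof.
move=> cardI; have [X [Xinf Xad]] := almost_disjoint_family cardI.
have /choice[a aP] := fun y => fact_sum_approx R (X y).
exists a => v sum0; apply: contrapT => v0.
have [y0 vy0] : exists y, v@_y != 0.
  apply: contrapT => nex; apply: v0; apply/malgP => y.
  by rewrite mcoeff0; apply/eqP; apply: contrapT => /negP vy; apply: nex; exists y.
have [d d0 dP] := common_denominator [seq v@_y | y <- msupp v].
pose c y : R := ratr (v@_y * d%:R).
have cint y : c y \is a Num.int.
  rewrite /c; have [yv|yv] := boolP (y \in msupp v).
    have /intrP[m ->] := dP v@_y (map_f _ yv).
    by rewrite ratr_int intr_int.
  by rewrite mcoeff_outdom// mul0r rmorph0.
have csum : \sum_(y <- msupp v) c y * a y = 0.
  transitivity (d%:R * \sum_(y <- msupp v) ratr v@_y * a y); last first.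
    by rewrite sum0 mulr0.
  rewrite mulr_sumr; apply: eq_bigr => y _.
  by rewrite /c rmorphM /= ratr_nat mulrAC mulrC.
pose C : R := \sum_(y <- msupp v) `|c y|.
pose Z N : R := \sum_(y <- msupp v) c y * fact_sum R (X y) N.
have Z0 N : 2 * C < N.+1%:R -> Z N.+1 = 0.
  move=> CN; have f0 : (0 : R) < N`!%:R by rewrite ltr0n fact_gt0.
  have Zint : N`!%:R * Z N.+1 \is a Num.int.
    rewrite mulr_sumr; apply: rpred_sum => y _.
    by rewrite mulrCA; apply: rpredM => //; exact: fact_sum_int.
  have ZC : `|Z N.+1| <= C * (2 / N.+1`!%:R).
    have -> : Z N.+1 = \sum_(y <- msupp v) c y * (fact_sum R (X y) N.+1 - a y).
      transitivity (Z N.+1 - \sum_(y <- msupp v) c y * a y).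
        by rewrite csum subr0.
      by rewrite /Z -sumrB; apply: eq_bigr => y _; ring.
    rewrite (le_trans (ler_norm_sum _ _ _))// mulr_suml; apply: ler_sum => y _.
    rewrite normrM ler_wpM2l// distrC ger0_norm; have := aP y N.+1 isT; lra.
  have : `|N`!%:R * Z N.+1| < 1.
    rewrite normrM ger0_norm ?ltW//; apply: (@le_lt_trans _ _ (2 * C / N.+1%:R)).
      have n0 : (N.+1%:R : R) != 0 by rewrite pnatr_eq0.
      apply: (le_trans (ler_wpM2l (ltW f0) ZC)).
      rewrite factS natrM le_eqVlt; apply/orP; left; apply/eqP; field.
      by rewrite nat1r n0 gt_eqF.
    by rewrite ltr_pdivrMr ?ltr0n// mul1r.
  have [/eqP|nz] := eqVneq (N`!%:R * Z N.+1) 0.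
    by rewrite mulf_eq0 gt_eqF//= => /eqP.
  by rewrite ltNge norm_intr_ge1.
have [K KP] : exists K, forall n, (K <= n)%N -> X y0 n ->
    forall y, y \in (msupp v : seq I) -> y <> y0 -> ~ X y n.
  elim: (msupp v : seq I) => [|z r [K KP]]; first by exists 0%N.
  have [zy|zy] := pselect (z = y0).
    exists K => n Kn Xn y; rewrite in_cons => /orP[/eqP -> //|yr]; exact: KP.
  have [k kP] := Xad y0 z (nesym zy); exists (maxn K k) => n.
  rewrite geq_max => /andP[Kn kn] Xn y; rewrite in_cons => /orP[/eqP -> _|yr].
    exact: kP.
  exact: KP.
have [n Nn Xn] := Xinf y0 (maxn K (Num.truncn (2 * C)).+1).
move: Nn; rewrite geq_max => /andP[Kn Cn].
have ltC m : (Num.truncn (2 * C) <= m)%N -> 2 * C < m.+1%:R.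
  by move=> Cm; apply: lt_le_trans (truncnS_gt _) _; rewrite ler_nat.
have : Z n.+1 - Z n = 0.
  rewrite Z0 ?ltC//; last exact: ltnW.
  by case: n Cn {Kn Xn} => // n Cn; rewrite Z0 ?ltC// subr0.
have -> : Z n.+1 - Z n = \sum_(y <- msupp v) c y * (`[< X y n >]%:R / n`!%:R).
  by rewrite -sumrB; apply: eq_bigr => y _; rewrite fact_sumS; ring.
rewrite (big_fsetD1 y0) -?mcoeff_neq0//= big1_fset ?addr0; last first.
  move=> y; rewrite in_fsetD1 => /andP[/eqP yy0 yv] _.
  by case: asboolP => [Xy|_]; [case: (KP n Kn Xn y yv yy0)|rewrite mul0r mulr0].
case: asboolP => // _ /eqP; rewrite mul1r mulf_eq0 invr_eq0 pnatr_eq0.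
rewrite (gtn_eqF (fact_gt0 n)) orbF /c
  fmorph_eq0 mulf_eq0 (negbTE vy0) pnatr_eq0 => /eqP d00.
by rewrite d00 in d0.
Qed.

Section hamel.
Variable R : realType.

Definition rat_independent (B : set R) := forall (r : seq R) (c : R -> rat),
  uniq r -> (forall x, x \in r -> B x) -> \sum_(x <- r) ratr (c x) * x = 0 ->
  forall x, x \in r -> c x = 0.

(** Zorn's lemma is applied to the sets B such that the union of A and B is
    independent, so that the empty chain is harmless. *)
Lemma hamel_basis (A : set R) : rat_independent A -> exists B : set R,
  [/\ A `<=` B, rat_independent B &
      forall x, exists (r : seq R) (c : R -> rat),
        (forall y, y \in r -> B y) /\ x = \sum_(y <- r) ratr (c y) * y].
Proof.
move=> iA.
have [|B [iB Bmax]] := @Zorn_bigcup R [set B | rat_independent (A `|` B)].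
  move=> F FP Ftot r c ur rF.
  have [F0|[B0 FB0]] : (F = set0) \/ (F !=set0).
    by have [->|/set0P] := eqVneq F set0; [left|right].
    apply: iA => // x /rF[//|[B]]; rewrite F0; by [].
  have [B [FB rB]] : exists B, F B /\ forall x, x \in r -> (A `|` B) x.
    elim: r rF {ur} => [|x r IH] rF; first by exists B0; split.
    have [|B [FB rB]] := IH; first by move=> y yr; apply: rF; rewrite in_cons yr orbT.
    have [Ax|[B' FB' B'x]] := rF x (mem_head _ _).
      by exists B; split => // y; rewrite in_cons => /orP[/eqP ->|/rB//]; left.
    have [BB'|B'B] := Ftot _ _ FB FB'.
      exists B'; split => // y; rewrite in_cons => /orP[/eqP ->|/rB[]].
      + by right.
      + by left.
      + by right; exact: BB'.
    exists B; split => // y; rewrite in_cons => /orP[/eqP ->|/rB//].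
    by right; exact: B'B.
  exact: (FP B FB).
exists (A `|` B); split; [exact: subsetUl|exact: iB|].
move=> x; have [ABx|nABx] := pselect ((A `|` B) x).
  exists [:: x], (fun=> 1); split; first by move=> y; rewrite inE => /eqP ->.
  by rewrite big_seq1 rmorph1 mul1r.
have : ~ rat_independent (A `|` (B `|` [set x])).
  apply: Bmax; split; first exact: subsetUl.
  by move=> /(_ x) H; apply: nABx; right; apply: H; right.
rewrite setUA => ndep.
have [r [c [ur rAB sum0 [y yr cy]]]] : exists (r : seq R) (c : R -> rat),
    [/\ uniq r, forall y, y \in r -> ((A `|` B) `|` [set x]) y,
      \sum_(y <- r) ratr (c y) * y = 0 & exists2 y, y \in r & c y != 0].
  apply: contrapT => nex; apply: ndep => r c ur rAB sum0 y yr.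
  by apply: contrapT => /eqP cy; apply: nex; exists r, c; split => //; exists y.
have rem_AB z : z \in seq.rem x r -> (A `|` B) z.
  rewrite mem_rem_uniq// inE => /andP[/eqP zx /rAB[//|]].
  by move=> zx'; case: zx.
have [xr|xr] := boolP (x \in r); last first.
  have := iB r c ur _ sum0 y yr; rewrite (rem_id xr) in rem_AB.
  by move=> /(_ rem_AB) cy0; rewrite cy0 eqxx in cy.
have cx : c x != 0.
  apply/eqP => cx; have [yx|yx] := eqVneq y x; first by rewrite yx cx eqxx in cy.
  have := iB (seq.rem x r) c (rem_uniq x ur) rem_AB.
  move: sum0; rewrite (big_rem _ xr) /= cx rmorph0 mul0r add0r => sum0.
  move=> /(_ sum0 y); rewrite mem_rem_uniq// inE yx yr => /(_ isT) cy0.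
  by rewrite cy0 eqxx in cy.
exists (seq.rem x r), (fun z => - (c z / c x)); split => //.
move: sum0; rewrite (big_rem _ xr) /= => /eqP; rewrite addr_eq0 => /eqP E.
have cx' : ratr (c x) != 0 :> R by rewrite fmorph_eq0.
apply: (mulfI cx'); rewrite E -sumrN mulr_sumr; apply: eq_bigr => z _.
rewrite rmorphN /= fmorph_div/=; field.
exact: cx'.
Qed.

End hamel.

Lemma additive_iso_real (R : realType) (I : choiceType) :
  [set: I] #= [set: nat -> bool] -> exists f : {additive 'Q^(I) -> R}, bijective f.
Proof.
move=> cardI; have [a aP] := independent_reals R cardI.
have ainj : injective a.
  move=> x y axy; apply/eqP; apply: contrapT => /negP xy.
  have H : mmap (ratr : rat -> R) a (<< 1 *g x >> - << 1 *g y >>) = 0.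
    by rewrite raddfB /= !mmapU axy subrr.
  have := congr1 (mcoeff x) (aP _ H).
  by rewrite mcoeffB !mcoeffU eqxx (eq_sym y) (negbTE xy) mcoeff0 subr0.
have iA : rat_independent (range a).
  move=> r c ur ra sum0 x xr.
  have /choice[b bP] : forall x, exists y, range a x -> a y = x.
    move=> z; have [[y _ <-]|nz] := pselect (range a z); first by exists y.
    by have [y _ _] := ra x xr; exists y.
  have rb z : z \in r -> a (b z) = z by move=> /ra; exact: bP.
  pose v : 'Q^(I) := \sum_(z <- r) << c z *g b z >>.
  have v0 : v = 0.
    apply: aP; rewrite -[LHS]/(mmap (ratr : rat -> R) a v) raddf_sum /= -[RHS]sum0.
    by apply: eq_big_seq => z zr; rewrite mmapU rb.
  have := congr1 (mcoeff (b x)) v0; rewrite mcoeff0 (raddf_sum (mcoeff (b x))).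
  rewrite (bigD1_seq x)//= mcoeffUU big_seq_cond big1 ?addr0//.
  move=> z /andP[zr zx]; rewrite mcoeffU; case: eqP => // bzx.
  by move/eqP: zx; case; rewrite -(rb z zr) bzx rb.
have [B [AB iB Bspan]] := hamel_basis iA.
have cardB : [set: I] #= [set: B].
  rewrite card_eq_le; apply/andP; split.
    apply: (@injective_card_le _ _ (fun x => SigSub (mem_set (AB _ (imageT a x))) : B)).
    by move=> x y /(congr1 val)/=; exact: ainj.
  apply: card_le_trans (injective_card_le val_inj) _.
  apply: card_le_trans (card_real_le R) _.
  by move: cardI; rewrite card_eq_le => /andP[].
have [b' [g b'K gK]] := card_eq_bijection cardB.
pose b x : R := val (b' x).
have binj : injective b by move=> x y /val_inj; exact: (can_inj b'K).
have bB x : B (b x) by exact: set_mem (valP (b' x)).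
have bsurj z : B z -> exists x, b x = z.
  by move=> Bz; exists (g (SigSub (mem_set Bz))); rewrite /b gK.
pose f : {additive 'Q^(I) -> R} := mmap (ratr : rat -> R) b.
have fsurj x : exists v, f v = x.
  have [r [c [rB ->]]] := Bspan x; elim: r rB => [|z r IH] rB.
    by exists 0; rewrite raddf0 big_nil.
  have [|v fv] := IH; first by move=> y yr; apply: rB; rewrite in_cons yr orbT.
  have [y byz] := bsurj z (rB z (mem_head _ _)).
  by exists (<< c z *g y >> + v); rewrite raddfD fv big_cons /f /= mmapU byz.
have finj v w : f v = f w -> v = w.
  move=> fvw; apply/eqP; rewrite -subr_eq0; apply/eqP.
  have : f (v - w) = 0 by rewrite raddfB fvw subrr.
  move: (v - w) => {fvw v w} v fv0; apply/malgP => y; rewrite mcoeff0.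
  have [yv|/mcoeff_outdom//] := boolP (y \in msupp v).
  have /choice[h hP] : forall z, exists x, B z -> b x = z.
    by move=> z; have [/bsurj[x bx]|nBz] := pselect (B z); [exists x|exists y].
  have hb x : h (b x) = x by apply: binj; rewrite hP.
  rewrite -(hb y).
  apply: (iB (map b (msupp v)) (fun x => v@_(h x))).
  - by rewrite map_inj_uniq.
  - by move=> _ /mapP[x _ ->].
  - by rewrite big_map -[RHS]fv0; apply: eq_bigr => x _; rewrite hb.
  - exact: map_f.
have /choice[k kP] := fsurj.
by exists f, k => // v; apply: finj; rewrite kP.
Qed.

Theorem proposition1p2 (R : realType) (I : choiceType)
    (cardI : [set: I] #= [set: nat -> bool]) :
  (exists f : {additive 'Q^(I) -> R}, bijective f) /\
  (exists tau : topology_on 'Q^(I),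
    [/\ group_topology tau,
        hausdorff_space (with_topology tau),
        countably_compact [set: with_topology tau] &
        forall (u : nat -> with_topology tau) (l : with_topology tau),
          u @ \oo --> l -> eventually_constant u]).
Proof.
split; first exact: additive_iso_real.
exact: (countably_compact_topology_exists R cardI).
Qed.
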